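(* Let $I$ be an ideal in a Noetherian ring $R$ and let $\mathbf x=x_1,\dots,x_n$ be a sequence of elements of $R$. Then the following statements hold: (i) If $\mathbf x$ is a quintasymptotic sequence over $I$ and $S$ is a multiplicatively closed subset of $R$ such that $(I,(\mathbf x))R_S\ne R_S$, then the image of $\mathbf x$ in $R_S$ is a quintasymptotic sequence over $IR_S$. The converse holds if $\mathfrak pR_S\ne R_S$ for all $\mathfrak p\in\bigcup_{i=0}^{n-1}\overline{Q^*}((I,(x_1,\dots,x_i)))$. (ii) If $\mathbf x$ is a maximal quintasymptotic sequence over $I$, then for each maximal ideal $\mathfrak m$ in $R$ containing $(I,(\mathbf x))$, the image of $\mathbf x$ in $R_{\mathfrak m}$ is a maximal quintasymptotic sequence over $IR_{\mathfrak m}$. The converse holds if the $x_i$ are contained in the Jacobson radical of $R$.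
   Context: All rings are commutative Noetherian with nonzero identity. $R_S$ is the localization of $R$ at $S$. For a prime ideal $\mathfrak p$ of a ring $R$, $R_{\mathfrak p}^*$ denotes the completion of the local ring $R_{\mathfrak p}$. A prime $\mathfrak p$ is a quintasymptotic prime of an ideal $I$ of $R$ if there is a minimal prime $z$ of $R_{\mathfrak p}^*$ with $\operatorname{Rad}(IR_{\mathfrak p}^*+z)=\mathfrak pR_{\mathfrak p}^*$; the set of these is $\overline{Q^*}(I)$. A sequence $x_1,\dots,x_n$ of elements of $R$ is a quintasymptotic sequence over $I$ if $(I,(x_1,\dots,x_n))\ne R$ and, for all $1\le i\le n$, $x_i$ lies in no prime of $\overline{Q^*}((I,(x_1,\dots,x_{i-1})))$. A quintasymptotic sequence $x_1,\dots,x_n$ over $I$ is maximal if $x_1,\dots,x_n,x_{n+1}$ is not a quintasymptotic sequence over $I$ for any $x_{n+1}\in R$.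
   Formalization: In the converse of (ii), I is assumed to be a proper ideal; for I = R no maximal ideal contains (I,(x)), so the local hypothesis is vacuous while x is never a quintasymptotic sequence over I, and the literal converse fails. *)

(* Defs.v *)
From HB Require Import structures.
From mathcomp Require Import all_boot all_order all_algebra.
From mathcomp Require Import boolp classical_sets.
From mathcomp Require Import ring.

Set Implicit Arguments.
Unset Strict Implicit.
Unset Printing Implicit Defensive.

Import GRing.Theory.

Local Open Scope classical_set_scope.
Local Open Scope quotient_scope.
Local Open Scope ring_scope.

(* Definitions are stated over comPzRingType, which includes the zero ring, *)
(* because the localization of a nonzero ring may be the zero ring.         *)

Section Ideals.
Variable R : comPzRingType.
Implicit Types I J p m S : set R.

Definition is_ideal I : Prop :=
  [/\ I 0, forall x y, I x -> I y -> I (x + y) & forall a x, I x -> I (a * x)].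

Definition ideal_gen (X : set R) : set R := smallest is_ideal X.

Definition ideal_mul I J : set R :=
  ideal_gen [set x | exists2 a, I a & exists2 b, J b & x = a * b].

Definition ideal_exp I (k : nat) : set R := iter k (ideal_mul I) setT.

Definition radical I : set R := [set x | exists n, I (x ^+ n)].

Definition is_prime p : Prop :=
  [/\ is_ideal p, p <> setT & forall x y, p (x * y) -> p x \/ p y].

Definition is_minimal_prime p : Prop :=
  is_prime p /\ forall q, is_prime q -> q `<=` p -> q = p.

Definition is_maximal m : Prop :=
  [/\ is_ideal m, m <> setT
    & forall J, is_ideal J -> m `<=` J -> J <> setT -> J = m].

Definition jacobson_radical : set R := \bigcap_(m in is_maximal) m.

Definition noetherian : Prop :=
  forall I, is_ideal I -> exists s : seq R, I = ideal_gen [set` s].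

Definition mul_closed S : Prop :=
  S 1 /\ forall s t, S s -> S t -> S (s * t).

Definition mul_gen S : set R := smallest mul_closed S.

Lemma ideal_gen_ideal X : is_ideal (ideal_gen X).
Proof.
split=> [I [[]]//|x y Ix Iy I hI|a x Ix I hI].
  by case: (hI) => -[_ addI _] _; apply: addI; [exact: Ix|exact: Iy].
by case: (hI) => -[_ _ mulI] _; apply: mulI; exact: Ix.
Qed.

Lemma mul_gen_closed S : mul_closed (mul_gen S).
Proof.
split=> [M [[]]//|s t Ms Mt M hM].
by case: (hM) => -[_ mulM] _; apply: mulM; [exact: Ms|exact: Mt].
Qed.

Lemma ideal_genN X x : ideal_gen X x -> ideal_gen X (- x).
Proof. by have [_ _ h] := ideal_gen_ideal X; rewrite -mulN1r; apply: h. Qed.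

End Ideals.

(* The extension of I along f; for f : R -> B this is I B. *)
Definition ideal_ext (R B : comPzRingType) (f : R -> B) (I : set R) : set B :=
  ideal_gen (f @` I).

Module RingQuot.
Section RingQuot.
Variables (R : comPzRingType) (X : set R).

Definition equiv (x y : R) : bool := `[< ideal_gen X (x - y) >].

Lemma equiv_is_equiv : equiv_class_of equiv.
Proof.
have [I0 addI _] := ideal_gen_ideal X.
split=> [x|x y|y x z]; first by apply/asboolP; rewrite subrr.
  by apply/asboolP/asboolP => /ideal_genN; rewrite opprB.
move=> /asboolP xy /asboolP yz; apply/asboolP.
by rewrite -[x](addrNK y) -addrA; exact: addI.
Qed.

Canonical equiv_equiv := EquivRelPack equiv_is_equiv.
Canonical equiv_encModRel := defaultEncModRel equiv.

(* The quotient of R by the ideal generated by X. *)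
Definition quot : Type := {eq_quot equiv}.

#[export]
HB.instance Definition _ : EqQuotient R equiv quot := EqQuotient.on quot.
#[export] HB.instance Definition _ := Choice.on quot.

Lemma eq_quotP x y : (x = y %[mod quot]) <-> ideal_gen X (x - y).
Proof.
split=> [/eqP|h]; first by rewrite piE => /asboolP.
by apply/eqP; rewrite piE; apply/asboolP.
Qed.

Lemma reprB x : ideal_gen X (repr (\pi_quot x) - x).
Proof. by apply/eq_quotP; rewrite reprK. Qed.

Definition zero : quot := lift_cst quot 0.
Definition one : quot := lift_cst quot 1.
Definition opp := lift_op1 quot -%R.
Definition add := lift_op2 quot +%R.
Definition mul := lift_op2 quot *%R.

Canonical pi_zero_morph := PiConst zero.
Canonical pi_one_morph := PiConst one.

Lemma pi_opp : {morph \pi_quot : x / - x >-> opp x}.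
Proof.
move=> x; unlock opp; apply/eq_quotP.
by rewrite opprK addrC; exact: reprB.
Qed.
Canonical pi_opp_morph := PiMorph1 pi_opp.

Lemma pi_add : {morph \pi_quot : x y / x + y >-> add x y}.
Proof.
have [_ addI _] := ideal_gen_ideal X.
move=> x y; unlock add; apply/esym/eq_quotP.
by rewrite opprD addrACA; apply: addI; exact: reprB.
Qed.
Canonical pi_add_morph := PiMorph2 pi_add.

Lemma pi_mul : {morph \pi_quot : x y / x * y >-> mul x y}.
Proof.
have [_ addI mulI] := ideal_gen_ideal X.
move=> x y; unlock mul; apply/esym/eq_quotP.
set x' := repr _; set y' := repr _.
have -> : x' * y' - x * y = y' * (x' - x) + x * (y' - y).
  by rewrite !mulrBr [y' * x']mulrC [y' * x]mulrC addrA subrK.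
by apply: addI; apply: mulI; exact: reprB.
Qed.
Canonical pi_mul_morph := PiMorph2 pi_mul.

Lemma addqA : associative add.
Proof. by move=> x y z; rewrite -[x]reprK -[y]reprK -[z]reprK !piE addrA. Qed.

Lemma addqC : commutative add.
Proof. by move=> x y; rewrite -[x]reprK -[y]reprK !piE addrC. Qed.

Lemma add0q : left_id zero add.
Proof. by move=> x; rewrite -[x]reprK !piE add0r. Qed.

Lemma addNq : left_inverse zero opp add.
Proof. by move=> x; rewrite -[x]reprK !piE addNr. Qed.

Lemma mulqA : associative mul.
Proof. by move=> x y z; rewrite -[x]reprK -[y]reprK -[z]reprK !piE mulrA. Qed.

Lemma mulqC : commutative mul.
Proof. by move=> x y; rewrite -[x]reprK -[y]reprK !piE mulrC. Qed.

Lemma mul1q : left_id one mul.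
Proof. by move=> x; rewrite -[x]reprK !piE mul1r. Qed.

Lemma mulqDl : left_distributive mul add.
Proof.
by move=> x y z; rewrite -[x]reprK -[y]reprK -[z]reprK !piE mulrDl.
Qed.

#[export]
HB.instance Definition _ := GRing.isZmodule.Build quot addqA addqC add0q addNq.
#[export] HB.instance Definition _ :=
  GRing.Zmodule_isComPzRing.Build quot mulqA mulqC mul1q mulqDl.

Definition proj (x : R) : quot := \pi_quot x.

Lemma proj_zmod_morphism : zmod_morphism proj.
Proof. by move=> x y; rewrite /proj pi_add pi_opp. Qed.

Lemma proj_monoid_morphism : monoid_morphism proj.
Proof. by split=> [|x y]; rewrite /proj ?pi_mul // piE. Qed.

#[export] HB.instance Definition _ :=
  GRing.isZmodMorphism.Build R quot proj proj_zmod_morphism.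
#[export] HB.instance Definition _ :=
  GRing.isMonoidMorphism.Build R quot proj proj_monoid_morphism.

End RingQuot.

Module Exports. HB.reexport. End Exports.
End RingQuot.
Export RingQuot.Exports.

Module Localization.
Section Localization.
Variables (R : comPzRingType) (S : set R).

Definition frac : Type := (R * set_type (mul_gen S))%type.

#[export] HB.instance Definition _ := Choice.on frac.

Definition num (x : frac) : R := x.1.
Definition den (x : frac) : R := val x.2.

Lemma denP x : mul_gen S (den x).
Proof. exact: set_mem (valP x.2). Qed.

Definition Frac (a s : R) (hs : mul_gen S s) : frac :=
  (a, Sub s (mem_set hs)).

Definition equiv (x y : frac) : bool :=
  `[< exists2 u, mul_gen S u & u * (num x * den y - num y * den x) = 0 >].

Lemma numE a s (hs : mul_gen S s) : num (Frac a hs) = a.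
Proof. by []. Qed.

Lemma denE a s (hs : mul_gen S s) : den (Frac a hs) = s.
Proof. exact: SubK. Qed.

Let SM s t : mul_gen S s -> mul_gen S t -> mul_gen S (s * t).
Proof. exact: (mul_gen_closed S).2. Qed.

Lemma equiv_is_equiv : equiv_class_of equiv.
Proof.
split=> [x|x y|y x z].
- by apply/asboolP; exists 1; [exact: (mul_gen_closed S).1|rewrite subrr mulr0].
- by apply/asboolP/asboolP => -[u Su e]; exists u => //;
     rewrite -opprB mulrN e oppr0.
move=> /asboolP[u Su e] /asboolP[v Sv f]; apply/asboolP.
exists (u * v * den y); first by do !apply: SM => //; exact: denP.
move: e f; rewrite !mulrBr => /eqP; rewrite subr_eq0 => /eqP e /eqP.
rewrite subr_eq0 => /eqP f; apply/eqP; rewrite subr_eq0; apply/eqP.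
ring: e f.
Qed.

Canonical equiv_equiv := EquivRelPack equiv_is_equiv.
Canonical equiv_encModRel := defaultEncModRel equiv.

Definition loc : Type := {eq_quot equiv}.

#[export]
HB.instance Definition _ : EqQuotient frac equiv loc := EqQuotient.on loc.
#[export] HB.instance Definition _ := Choice.on loc.

Lemma eq_locP x y : (x = y %[mod loc]) <->
  exists2 u, mul_gen S u & u * (num x * den y - num y * den x) = 0.
Proof.
split=> [/eqP|h]; first by rewrite piE => /asboolP.
by apply/eqP; rewrite piE; apply/asboolP.
Qed.

Lemma repr_locP x : exists2 u, mul_gen S u &
  u * (num (repr (\pi_loc x)) * den x - num x * den (repr (\pi_loc x))) = 0.
Proof. by apply/eq_locP; rewrite reprK. Qed.

Definition zerof : frac := Frac 0 (mul_gen_closed S).1.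
Definition onef : frac := Frac 1 (mul_gen_closed S).1.
Definition oppf (x : frac) : frac := Frac (- num x) (denP x).
Definition addf (x y : frac) : frac :=
  Frac (num x * den y + num y * den x) (SM (denP x) (denP y)).
Definition mulf (x y : frac) : frac :=
  Frac (num x * num y) (SM (denP x) (denP y)).

Definition zero : loc := lift_cst loc zerof.
Definition one : loc := lift_cst loc onef.
Definition opp := lift_op1 loc oppf.
Definition add := lift_op2 loc addf.
Definition mul := lift_op2 loc mulf.

Canonical pi_zero_morph := PiConst zero.
Canonical pi_one_morph := PiConst one.

Lemma pi_opp : {morph \pi_loc : x / oppf x >-> opp x}.
Proof.
move=> x; unlock opp; apply/esym/eq_locP.
have [u Su e] := repr_locP x; exists u => //.
by rewrite !(numE, denE) !mulNr -opprD mulrN e oppr0.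
Qed.
Canonical pi_opp_morph := PiMorph1 pi_opp.

Let add_compat (u v a s a' s' b t b' t' : R) :
  u * (a * s' - a' * s) = 0 -> v * (b * t' - b' * t) = 0 ->
  (u * v) * ((a * t + b * s) * (s' * t') - (a' * t' + b' * s') * (s * t)) = 0.
Proof.
move=> e f; transitivity (v * t * t' * (u * (a * s' - a' * s))
  + u * s * s' * (v * (b * t' - b' * t))); first by ring.
by rewrite e f !mulr0 addr0.
Qed.

Let mul_compat (u v a s a' s' b t b' t' : R) :
  u * (a * s' - a' * s) = 0 -> v * (b * t' - b' * t) = 0 ->
  (u * v) * ((a * b) * (s' * t') - (a' * b') * (s * t)) = 0.
Proof.
move=> e f; transitivity (v * b * t' * (u * (a * s' - a' * s))
  + u * a' * s * (v * (b * t' - b' * t))); first by ring.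
by rewrite e f !mulr0 addr0.
Qed.

Lemma pi_add : {morph \pi_loc : x y / addf x y >-> add x y}.
Proof.
move=> x y; unlock add; apply/esym/eq_locP.
have [u Su e] := repr_locP x; have [v Sv f] := repr_locP y.
by exists (u * v); [exact: SM | rewrite !(numE, denE); exact: add_compat].
Qed.
Canonical pi_add_morph := PiMorph2 pi_add.

Lemma pi_mul : {morph \pi_loc : x y / mulf x y >-> mul x y}.
Proof.
move=> x y; unlock mul; apply/esym/eq_locP.
have [u Su e] := repr_locP x; have [v Sv f] := repr_locP y.
by exists (u * v); [exact: SM | rewrite !(numE, denE); exact: mul_compat].
Qed.
Canonical pi_mul_morph := PiMorph2 pi_mul.

Lemma eq_loc x y : num x * den y = num y * den x -> x = y %[mod loc].
Proof.
move=> e; apply/eq_locP; exists 1; first exact: (mul_gen_closed S).1.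
by rewrite e subrr mulr0.
Qed.

Lemma addqA : associative add.
Proof.
move=> x y z; rewrite -[x]reprK -[y]reprK -[z]reprK !piE.
by apply: eq_loc; rewrite !(numE, denE); ring.
Qed.

Lemma addqC : commutative add.
Proof.
move=> x y; rewrite -[x]reprK -[y]reprK !piE.
by apply: eq_loc; rewrite !(numE, denE); ring.
Qed.

Lemma add0q : left_id zero add.
Proof.
move=> x; rewrite -[x]reprK !piE.
by apply: eq_loc; rewrite !(numE, denE); ring.
Qed.

Lemma addNq : left_inverse zero opp add.
Proof.
move=> x; rewrite -[x]reprK !piE.
by apply: eq_loc; rewrite !(numE, denE); ring.
Qed.

Lemma mulqA : associative mul.
Proof.
move=> x y z; rewrite -[x]reprK -[y]reprK -[z]reprK !piE.
by apply: eq_loc; rewrite !(numE, denE); ring.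
Qed.

Lemma mulqC : commutative mul.
Proof.
move=> x y; rewrite -[x]reprK -[y]reprK !piE.
by apply: eq_loc; rewrite !(numE, denE); ring.
Qed.

Lemma mul1q : left_id one mul.
Proof.
move=> x; rewrite -[x]reprK !piE.
by apply: eq_loc; rewrite !(numE, denE); ring.
Qed.

Lemma mulqDl : left_distributive mul add.
Proof.
move=> x y z; rewrite -[x]reprK -[y]reprK -[z]reprK !piE.
by apply: eq_loc; rewrite !(numE, denE); ring.
Qed.

#[export]
HB.instance Definition _ := GRing.isZmodule.Build loc addqA addqC add0q addNq.
#[export] HB.instance Definition _ :=
  GRing.Zmodule_isComPzRing.Build loc mulqA mulqC mul1q mulqDl.

Definition map (a : R) : loc := \pi_loc (Frac a (mul_gen_closed S).1).

Lemma map_zmod_morphism : zmod_morphism map.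
Proof.
move=> x y; pose f a := Frac a (mul_gen_closed S).1.
transitivity (\pi_loc (addf (f x) (oppf (f y)))); last by rewrite pi_add pi_opp.
by apply: eq_loc; rewrite !(numE, denE); ring.
Qed.

Lemma map_monoid_morphism : monoid_morphism map.
Proof.
split=> [|x y]; first by rewrite /map !piE.
pose f a := Frac a (mul_gen_closed S).1.
transitivity (\pi_loc (mulf (f x) (f y))); last by rewrite pi_mul.
by apply: eq_loc; rewrite !(numE, denE); ring.
Qed.

#[export] HB.instance Definition _ :=
  GRing.isZmodMorphism.Build R loc map map_zmod_morphism.
#[export] HB.instance Definition _ :=
  GRing.isMonoidMorphism.Build R loc map map_monoid_morphism.

End Localization.

Module Exports. HB.reexport. End Exports.
End Localization.
Export Localization.Exports.

(* The inverse limit of the rings R / J^k. *)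
Module Completion.
Section Completion.
Variables (R : comPzRingType) (J : set R).

Definition layer (k : nat) : comPzRingType := RingQuot.quot (ideal_exp J k).

(* The canonical surjection R / J^(k+1) -> R / J^k; see transition_proj. *)
Definition transition (k : nat) (x : layer k.+1) : layer k :=
  RingQuot.proj (ideal_exp J k) (repr x).

Record compl : Type := Compl {
  component :> forall k, layer k;
  _ : forall k, transition (component k.+1) = component k }.

#[export] HB.instance Definition _ := gen_eqMixin compl.
#[export] HB.instance Definition _ := gen_choiceMixin compl.

Lemma complP (x y : compl) : (forall k, x k = y k) -> x = y.
Proof.
case: x y => [x hx] [y hy] /= e.
have {}e : x = y by apply: functional_extensionality_dep.
by rewrite {}e in hx *; congr Compl; exact: Prop_irrelevance.
Qed.

Lemma ideal_exp_ideal k : is_ideal (ideal_exp J k).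
Proof. by case: k => [|k]; [split | exact: ideal_gen_ideal]. Qed.

Lemma ideal_expS k : ideal_exp J k.+1 `<=` ideal_exp J k.
Proof.
apply: smallest_sub; first exact: ideal_exp_ideal.
move=> _ [a _ [b Jb ->]]; have [_ _] := ideal_exp_ideal k; exact.
Qed.

Lemma transition_proj k (a : R) :
  transition (RingQuot.proj (ideal_exp J k.+1) a)
  = RingQuot.proj (ideal_exp J k) a.
Proof.
apply/RingQuot.eq_quotP; apply: sub_gen_smallest; apply: ideal_expS.
have := @RingQuot.reprB R (ideal_exp J k.+1) a.
by rewrite /ideal_gen (smallest_id (ideal_exp_ideal k.+1)).
Qed.

Lemma layer_surj k (x : layer k) : exists a, x = RingQuot.proj _ a.
Proof. by exists (repr x); rewrite /RingQuot.proj reprK. Qed.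

Lemma transition_zmod_morphism k : zmod_morphism (@transition k).
Proof.
move=> x y; have [[a ->] [b ->]] := (layer_surj x, layer_surj y).
by rewrite -rmorphB !transition_proj rmorphB.
Qed.

Lemma transition_monoid_morphism k : monoid_morphism (@transition k).
Proof.
split=> [|x y].
  by rewrite -(rmorph1 (RingQuot.proj _)) transition_proj rmorph1.
have [[a ->] [b ->]] := (layer_surj x, layer_surj y).
by rewrite -rmorphM !transition_proj rmorphM.
Qed.

#[export] HB.instance Definition _ k := GRing.isZmodMorphism.Build
  (layer k.+1) (layer k) (@transition k) (@transition_zmod_morphism k).
#[export] HB.instance Definition _ k := GRing.isMonoidMorphism.Build
  (layer k.+1) (layer k) (@transition k) (@transition_monoid_morphism k).

Lemma componentP (x : compl) k : transition (x k.+1) = x k.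
Proof. by case: x. Qed.

Definition zero : compl := @Compl (fun=> 0) (fun k => rmorph0 (@transition k)).
Definition one : compl := @Compl (fun=> 1) (fun k => rmorph1 (@transition k)).

Fact opp_subproof (x : compl) k : transition (- x k.+1) = - x k.
Proof. by rewrite rmorphN /= componentP. Qed.
Definition opp x : compl := Compl (opp_subproof x).

Fact add_subproof (x y : compl) k :
  transition (x k.+1 + y k.+1) = x k + y k.
Proof. by rewrite rmorphD /= !componentP. Qed.
Definition add x y : compl := Compl (add_subproof x y).

Fact mul_subproof (x y : compl) k :
  transition (x k.+1 * y k.+1) = x k * y k.
Proof. by rewrite rmorphM /= !componentP. Qed.
Definition mul x y : compl := Compl (mul_subproof x y).

Lemma addcA : associative add.
Proof. by move=> x y z; apply: complP => k; exact: addrA. Qed.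

Lemma addcC : commutative add.
Proof. by move=> x y; apply: complP => k; exact: addrC. Qed.

Lemma add0c : left_id zero add.
Proof. by move=> x; apply: complP => k; exact: add0r. Qed.

Lemma addNc : left_inverse zero opp add.
Proof. by move=> x; apply: complP => k; exact: addNr. Qed.

Lemma mulcA : associative mul.
Proof. by move=> x y z; apply: complP => k; exact: mulrA. Qed.

Lemma mulcC : commutative mul.
Proof. by move=> x y; apply: complP => k; exact: mulrC. Qed.

Lemma mul1c : left_id one mul.
Proof. by move=> x; apply: complP => k; exact: mul1r. Qed.

Lemma mulcDl : left_distributive mul add.
Proof. by move=> x y z; apply: complP => k; exact: mulrDl. Qed.

#[export]
HB.instance Definition _ := GRing.isZmodule.Build compl addcA addcC add0c addNc.
#[export] HB.instance Definition _ :=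
  GRing.Zmodule_isComPzRing.Build compl mulcA mulcC mul1c mulcDl.

Definition map (a : R) : compl :=
  @Compl (fun k => RingQuot.proj (ideal_exp J k) a)
         (fun k => transition_proj k a).

Lemma map_zmod_morphism : zmod_morphism map.
Proof. by move=> x y; apply: complP => k; exact: rmorphB. Qed.

Lemma map_monoid_morphism : monoid_morphism map.
Proof.
by split=> [|x y]; apply: complP => k; [exact: rmorph1 | exact: rmorphM].
Qed.

#[export] HB.instance Definition _ :=
  GRing.isZmodMorphism.Build R compl map map_zmod_morphism.
#[export] HB.instance Definition _ :=
  GRing.isMonoidMorphism.Build R compl map map_monoid_morphism.

End Completion.

Module Exports. HB.reexport. End Exports.
End Completion.
Export Completion.Exports.

(* [S^-1]R inverts the submonoid mul_gen S generated by S, which is S itself *)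
(* when mul_closed S.                                                        *)
Notation localization S := (Localization.loc S).
Notation loc_map S := (Localization.map S).
Notation completion J := (Completion.compl J).
Notation completion_map J := (Completion.map J).

Section Quintasymptotic.
Variable R : comPzRingType.
Implicit Types (I p : set R) (xs : seq R).

Definition local_ring p : comPzRingType := localization (~` p).

Definition local_map p : R -> local_ring p := loc_map (~` p).

(* The maximal ideal of R_p is p R_p. *)
Definition completed_local_ring p : comPzRingType :=
  completion (ideal_ext (@local_map p) p).

Definition completed_local_map p : R -> completed_local_ring p :=
  completion_map (ideal_ext (@local_map p) p) \o @local_map p.

Definition quintasymptotic_primes I : set (set R) :=
  [set p | is_prime p /\
     exists2 z : set (completed_local_ring p), is_minimal_prime z &
       radical (ideal_gen (ideal_ext (@completed_local_map p) I `|` z))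
       = ideal_ext (@completed_local_map p) p].

(* The ideal (I, (x_1, ..., x_n)). *)
Definition ideal_adjoin I xs : set R := ideal_gen (I `|` [set` xs]).

Definition quintasymptotic_sequence I xs : Prop :=
  ideal_adjoin I xs <> setT /\
  forall i, (i < size xs)%N ->
    forall p, quintasymptotic_primes (ideal_adjoin I (take i xs)) p ->
      ~ p xs`_i.

Definition maximal_quintasymptotic_sequence I xs : Prop :=
  quintasymptotic_sequence I xs /\
  forall y, ~ quintasymptotic_sequence I (rcons xs y).

End Quintasymptotic.

(* Main.v *)
Require Import Defs.
From HB Require Import structures.
From mathcomp Require Import all_boot all_algebra.
From mathcomp Require Import boolp classical_sets.
From mathcomp Require Import ring.

Set Implicit Arguments.
Unset Strict Implicit.
Unset Printing Implicit Defensive.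

Import GRing.Theory.

Local Open Scope classical_set_scope.
Local Open Scope quotient_scope.
Local Open Scope ring_scope.

(** Localization preserves quintasymptotic primes: if the prime [p] is disjoint
    from [S], then [R_p] and [(R_S)_(p R_S)] are isomorphic, hence so are their
    completions, and [p R_S] is a quintasymptotic prime of [I R_S] exactly when
    [p] is one of [I] ([quintasymptotic_primes_localization]).  As the primes
    of [R_S] are the [p R_S], this gives (i), and also the converse in (ii):
    a failure of the sequence to be quintasymptotic, or to be maximal, shows
    in the localization at some maximal ideal containing [I], and the
    Jacobson radical hypothesis places the sequence in that ideal.

    The direct part of (ii) needs more.  Write [J] for [(I, xs)].  Maximality
    says that each maximal ideal [m] containing [J] is covered by the
    quintasymptotic primes of [J].  Once these are known to be finite in
    number ([quintasymptotic_primes_finite]), prime avoidance shows that [m]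
    is one of them; then [m R_m] is a quintasymptotic prime of [J R_m], and no
    element of [m R_m] extends the sequence.

    Finiteness follows from two facts.

    - A quintasymptotic prime [p] of [J] has the form [(J ^ n : a)]
      ([quintasymptotic_primes_ass]).  In the completion [C] of [R_p] let [z]
      be a minimal prime such that the radical of [J C + z] is [p C].  Elements
      of [z] are nilpotent up to a multiplier outside [z], so there is a
      nonzero [s] in [C] such that, for every [n], a power of [p] multiplies
      [s] into [J ^ n C].  If no [(J ^ n : a)] were [p], then
      [(J ^ n R_p : p R_p)] would be [J ^ n R_p] for all [n], and a weak form
      of the Artin-Rees lemma would place [s] arbitrarily close to
      [J ^ n R_p] for all [n]; since [J] is in [p], this forces [s = 0].

    - The primes [(J ^ n : a)], for all [n] and [a] together, are finite in
      number ([finite_associated_primes_powers]): they are traces on [R] of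
      annihilators of homogeneous elements of the associated graded ring of
      [J], which is Noetherian by Hilbert's basis theorem, and the usual
      Noetherian induction bounds the set of such traces. *)

(** * Ideals *)

Section IdealBasics.
Variable R : comPzRingType.
Implicit Types (I J K E : set R) (a b x y : R).

Lemma ideal_addr I x y : is_ideal I -> I x -> I y -> I (x + y).
Proof. by case=> _ h _; exact: h. Qed.

Lemma ideal_mull I a x : is_ideal I -> I x -> I (a * x).
Proof. by case=> _ _ h; exact: h. Qed.

Lemma ideal_mulr I a x : is_ideal I -> I x -> I (x * a).
Proof. by rewrite mulrC; exact: ideal_mull. Qed.

Lemma ideal_oppr I x : is_ideal I -> I x -> I (- x).
Proof. by rewrite -mulN1r; exact: ideal_mull. Qed.

Lemma ideal_subr I x y : is_ideal I -> I x -> I y -> I (x - y).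
Proof. by move=> hI hx hy; apply: ideal_addr => //; exact: ideal_oppr. Qed.

Lemma ideal_gen_sub (X : set R) : X `<=` ideal_gen X.
Proof. exact: sub_gen_smallest. Qed.

Lemma ideal_gen_min (X : set R) K :
  is_ideal K -> X `<=` K -> ideal_gen X `<=` K.
Proof. exact: smallest_sub. Qed.

Lemma ideal_gen_id K : is_ideal K -> ideal_gen K = K.
Proof. exact: smallest_id. Qed.

Lemma ideal_genS (X Y : set R) : X `<=` Y -> ideal_gen X `<=` ideal_gen Y.
Proof.
move=> XY; apply: ideal_gen_min; first exact: ideal_gen_ideal.
by apply: (subset_trans XY); exact: ideal_gen_sub.
Qed.

Lemma ideal_eqT I : is_ideal I -> I 1 -> I = setT.
Proof.
move=> hI h1; apply/seteqP; split=> // x _.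
by rewrite -[x]mulr1; exact: ideal_mull.
Qed.

Lemma ideal_proper1 I : is_ideal I -> I <> setT -> ~ I 1.
Proof. by move=> hI hT h1; apply: hT; exact: ideal_eqT. Qed.

Lemma colon_ideal K a : is_ideal K -> is_ideal [set x | K (x * a)].
Proof.
move=> hK; split=> [|x y|b x] /=; first by rewrite mul0r; case: hK.
- by rewrite mulrDl; exact: ideal_addr.
- by rewrite -mulrA; exact: ideal_mull.
Qed.

Lemma ideal_gen_cons K a x : is_ideal K ->
  ideal_gen (K `|` [set a]) x -> exists2 k, K k & exists r, x = k + r * a.
Proof.
move=> hK; apply: (ideal_gen_min
  (K := [set x | exists2 k, K k & exists r, x = k + r * a])).
  split=> [|_ _ [k Kk [r ->]] [l Kl [s ->]]|b _ [k Kk [r ->]]].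
  - by exists 0; [case: hK|exists 0; rewrite mul0r addr0].
  - by exists (k + l); [exact: ideal_addr|exists (r + s); ring].
  - by exists (b * k); [exact: ideal_mull|exists (b * r); ring].
move=> y [Ky|->]; first by exists y => //; exists 0; ring.
by exists 0; [case: hK|exists 1; ring].
Qed.

Lemma ideal_gen_setU I J x : is_ideal I -> is_ideal J ->
  ideal_gen (I `|` J) x -> exists2 a, I a & exists2 b, J b & x = a + b.
Proof.
move=> hI hJ; apply: (ideal_gen_min
  (K := [set x | exists2 a, I a & exists2 b, J b & x = a + b])).
  split=> [|_ _ [a Ia [b Jb ->]] [c Ic [d Jd ->]]|r _ [a Ia [b Jb ->]]].
  - by exists 0; [case: hI|exists 0; [case: hJ|rewrite addr0]].
  - by exists (a + c); [exact: ideal_addr|exists (b + d);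
      [exact: ideal_addr|rewrite addrACA]].
  - by exists (r * a); [exact: ideal_mull|exists (r * b);
      [exact: ideal_mull|rewrite mulrDr]].
move=> y [Iy|Jy].
  by exists y => //; exists 0; [case: hJ|rewrite addr0].
by exists 0; [case: hI|exists y => //; rewrite add0r].
Qed.

(** [Zorn_bigcup] also asks for the union of the empty chain, which is not an
    ideal; it is applied to the family enlarged by the empty set. *)
Lemma ideal_zorn (F : set (set R)) K0 :
  F `<=` @is_ideal R -> F K0 ->
  (forall C, C `<=` F -> C !=set0 -> total_on C subset ->
     is_ideal (\bigcup_(K in C) K) -> F (\bigcup_(K in C) K)) ->
  exists2 K, F K & forall K', F K' -> K `<=` K' -> K' = K.
Proof.
move=> Fid FK0 Fch; pose P K := K = set0 \/ F K.
have [C CP Ctot|K [[K0'|FK] Kmax]] := @Zorn_bigcup R P.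
- have [[X [CX FX]]|noX] := pselect (exists X, C X /\ F X); last first.
    left; apply/seteqP; split=> // x [X CX Xx].
    have [X0|FX] := CP _ CX; first by rewrite X0 in Xx.
    by case: noX; exists X.
  right; pose C' := C `&` F.
  have -> : \bigcup_(K in C) K = \bigcup_(K in C') K.
    apply/seteqP; split=> x [Y CY Yx]; last by case: CY => CY _; exists Y.
    by exists Y => //; split=> //; have [Y0|//] := CP _ CY; rewrite Y0 in Yx.
  apply: Fch => [Y []//||Y Z [CY _] [CZ _]|]; first by exists X.
    exact: Ctot.
  split=> [|x y [Y [CY FY] Yx] [Z [CZ FZ] Zy]|a x [Y [CY FY] Yx]].
  - by exists X => //; case: (Fid _ FX).
  - have [YZ|ZY] := Ctot _ _ CY CZ.
      by exists Z => //; apply: ideal_addr => //; [exact: Fid|exact: YZ].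
    by exists Y => //; apply: ideal_addr => //; [exact: Fid|exact: ZY].
  - by exists Y => //; apply: ideal_mull => //; exact: Fid.
- suff: K `<` K0 by move=> /Kmax; case; right.
  rewrite K0'; split=> //; case: (Fid _ FK0) => h _ _ h0; exact: (h0 0).
- exists K => // K' FK' KK'; apply/seteqP; split=> //.
  by apply: contrapT => nK'K; apply: (Kmax K'); [split|right].
Qed.

(** The union of a chain is generated by finitely many elements, all of which
    lie in one member of the chain, so the union is that member. *)
Lemma noetherian_max (F : set (set R)) K0 : noetherian R ->
  F `<=` @is_ideal R -> F K0 ->
  exists2 K, F K & forall K', F K' -> K `<=` K' -> K' = K.
Proof.
move=> noeth Fid FK0; apply: ideal_zorn FK0 _ => // C CF [X CX] Ctot Uid.
have [s Us] := noeth _ Uid.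
suff [Y CY sY] : exists2 Y, C Y & [set` s] `<=` Y.
  suff -> : \bigcup_(K in C) K = Y by exact: CF.
  apply/seteqP; split; last by move=> x Yx; exists Y.
  by rewrite Us; apply: ideal_gen_min => //; exact/Fid/CF.
have : [set` s] `<=` \bigcup_(K in C) K by rewrite Us; exact: ideal_gen_sub.
elim: s {Us} => [_|x s IH xsU]; first by exists X.
have [|Y CY sY] := IH; first by move=> y ys; apply: xsU; rewrite /= inE ys orbT.
have [|Z CZ Zx] := xsU x; first by rewrite /= mem_head.
have [YZ|ZY] := Ctot _ _ CY CZ.
  by exists Z => // y; rewrite /= inE => /orP[/eqP->//|/sY/YZ].
by exists Y => // y; rewrite /= inE => /orP[/eqP->|/sY//]; exact: ZY.
Qed.

Lemma prime_ideal (p : set R) : is_prime p -> is_ideal p. Proof. by case. Qed.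

Lemma prime_mul_closed (p : set R) : is_prime p -> mul_closed (~` p).
Proof.
case=> hp pT pM; split; first exact: ideal_proper1.
by move=> s t ps pt /pM[].
Qed.

(** If [x] and [y] are outside [K], then [T] meets [K + (x)] and [K + (y)];
    the product of two common elements is in [T] and in [K + (x * y)]. *)
Lemma maximal_avoiding_prime (T : set R) K : mul_closed T ->
  is_ideal K -> K `&` T = set0 ->
  (forall K', is_ideal K' -> K' `&` T = set0 -> K `<=` K' -> K' = K) ->
  is_prime K.
Proof.
move=> [T1 TM] hK KT Kmax.
have avoid x : K x -> ~ T x.
  by move=> Kx Tx; have : (K `&` T) x by []; rewrite KT.
split=> // [KE|x y Kxy]; first by apply: (avoid 1) => //; rewrite KE.
have meet z : ~ K z ->
    exists2 t, T t & exists2 k, K k & exists r, t = k + r * z.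
  move=> Kz; pose K' := ideal_gen (K `|` [set z]).
  have [e|/eqP/set0P[t [K't Tt]]] := pselect (K' `&` T = set0); last first.
    by exists t => //; exact: ideal_gen_cons.
  case: Kz; rewrite -(Kmax K') //; first by apply: ideal_gen_sub; right.
    exact: ideal_gen_ideal.
  by move=> u Ku; apply: ideal_gen_sub; left.
apply: contrapT => /not_orP[].
move=> /meet[t Tt [k Kk [r te]]] /meet[u Tu [l Kl [s ue]]].
apply: (avoid (t * u)); last exact: TM.
have -> : t * u = (l + s * y) * k + (r * x) * l + (r * s) * (x * y).
  by rewrite te ue; ring.
by do !apply: ideal_addr => //; apply: ideal_mull.
Qed.

Lemma maximal_prime (m : set R) : is_maximal m -> is_prime m.
Proof.
case=> hm mT mmax; apply: (@maximal_avoiding_prime [set 1]) => //.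
- by split=> // s t /= -> ->; rewrite mulr1.
- by apply/seteqP; split=> // x [mx x1]; case: mT; apply: ideal_eqT => //;
    rewrite -x1.
- move=> K hK K1 mK; apply: mmax => // KT.
  have : (K `&` [set 1]) 1 by rewrite KT.
  by rewrite K1.
Qed.

Lemma noetherian_sub_maximal I : noetherian R -> is_ideal I -> I <> setT ->
  exists2 m, is_maximal m & I `<=` m.
Proof.
move=> noeth hI IT.
pose F := [set K | [/\ is_ideal K, K <> setT & I `<=` K]].
have [||m [hm mT Im] mmax] := @noetherian_max F I noeth; first by move=> K [].
  by split.
exists m => //; split=> // J hJ mJ JT; apply: mmax => //; split=> //.
exact: subset_trans mJ.
Qed.

(** An element of a minimal prime is nilpotent up to a multiplier outside
    that prime: otherwise the multiplicative set of the [s * b ^+ n] with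
    [s] outside [z] is avoided by a prime, which is smaller than [z]. *)
Lemma minimal_prime_nilpotent (z : set R) b : is_minimal_prime z -> z b ->
  exists2 s, ~ z s & exists n, s * b ^+ n = 0.
Proof.
move=> [zp zmin] zb; apply: contrapT => nos.
have [z1 zM] := prime_mul_closed zp.
pose T := [set t | exists2 s, ~ z s & exists n, t = s * b ^+ n].
have Tcl : mul_closed T.
  split; first by exists 1 => //; exists 0%N; rewrite mulr1.
  move=> _ _ [s zs [n ->]] [t zt [k ->]].
  by exists (s * t); [exact: zM|exists (n + k)%N; rewrite exprD; ring].
pose F := [set K | is_ideal K /\ K `&` T = set0].
have [|||q [hq qT] qmax] := @ideal_zorn F [set 0].
- by move=> K [].
- split.
    split=> [//|x y /= -> ->|a x /= ->]; first by rewrite addr0.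
    by rewrite mulr0.
  apply/seteqP; split=> // x [-> [s zs [n e]]]; apply: nos.
  by exists s => //; exists n.
- move=> C CF _ _ Uid; split=> //; apply/seteqP; split=> // x [[X CX Xx] Tx].
  by have [_ <-] := CF _ CX.
have qp : is_prime q.
  by apply: (maximal_avoiding_prime Tcl hq qT) => K hK KT qK; exact: qmax.
have avoid x : q x -> ~ T x.
  by move=> qx Tx; have : (q `&` T) x by []; rewrite qT.
have qz : q `<=` z.
  move=> x qx; apply: contrapT => zx; apply: (avoid x) => //.
  by exists x => //; exists 0%N; rewrite mulr1.
apply: (avoid b); first by rewrite (zmin _ qp qz).
by exists 1 => //; exists 1%N; rewrite mul1r.
Qed.

End IdealBasics.

(** * Powers of ideals *)

Section Powers.
Variable R : comPzRingType.
Implicit Types (I J K E : set R) (a b x y : R).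

Lemma ideal_mul_ideal I J : is_ideal (ideal_mul I J).
Proof. exact: ideal_gen_ideal. Qed.

Lemma ideal_mul_mem I J a b : I a -> J b -> ideal_mul I J (a * b).
Proof. by move=> Ia Jb; apply: ideal_gen_sub; exists a => //; exists b. Qed.

Lemma ideal_mul_min I J K : is_ideal K ->
  (forall a b, I a -> J b -> K (a * b)) -> ideal_mul I J `<=` K.
Proof.
by move=> hK h; apply: ideal_gen_min => // _ [a Ia [b Jb ->]]; exact: h.
Qed.

Lemma ideal_exp_ideal I n : is_ideal (ideal_exp I n).
Proof. exact: Completion.ideal_exp_ideal. Qed.

Lemma ideal_exp_le I n k : (n <= k)%N -> ideal_exp I k `<=` ideal_exp I n.
Proof.
move=> /subnK <-; elim: (k - n)%N => // l IH.
by apply: subset_trans IH; exact: Completion.ideal_expS.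
Qed.

Lemma ideal_exp1 I : is_ideal I -> ideal_exp I 1 = I.
Proof.
move=> hI; apply/seteqP; split=> [|x Ix].
  by apply: ideal_mul_min => // a b Ia _; exact: ideal_mulr.
by rewrite -[x]mulr1; exact: ideal_mul_mem.
Qed.

Lemma ideal_exp_mem I n a : I a -> ideal_exp I n (a ^+ n).
Proof.
by move=> Ia; elim: n => // n IH; rewrite exprS; exact: ideal_mul_mem.
Qed.

Lemma ideal_exp_mono I J n : I `<=` J -> ideal_exp I n `<=` ideal_exp J n.
Proof.
move=> IJ; elim: n => // n IH; apply: ideal_mul_min.
  exact: ideal_mul_ideal.
by move=> a b Ia Ib; apply: ideal_mul_mem; [exact: IJ|exact: IH].
Qed.

Lemma ideal_exp_add I i j a b :
  ideal_exp I i a -> ideal_exp I j b -> ideal_exp I (i + j) (a * b).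
Proof.
move=> Ia Ib; move: a Ia; elim: i => [a _|i IH].
  by apply: ideal_mull => //; exact: ideal_exp_ideal.
apply: (ideal_mul_min (K := [set a | ideal_exp I (i.+1 + j) (a * b)])).
  by apply: colon_ideal; exact: ideal_exp_ideal.
by move=> a c Ia Ic /=; rewrite -mulrA; apply: ideal_mul_mem => //; exact: IH.
Qed.

Lemma ideal_gen_seq_cons x (s : seq R) y : ideal_gen [set` x :: s] y ->
  exists2 k, ideal_gen [set` s] k & exists r, y = k + r * x.
Proof.
move=> h; apply: ideal_gen_cons; first exact: ideal_gen_ideal.
apply: ideal_genS h => z; rewrite /= inE => /orP[/eqP->|zs]; first by right.
by left; exact: ideal_gen_sub.
Qed.

(** Expand a product of [n] sums [k + r * x] with [k] in [(s)]. *)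
Lemma ideal_exp_cons x (s : seq R) n :
  ideal_exp (ideal_gen [set` x :: s]) n `<=`
  ideal_gen [set y | exists i j, (i + j = n)%N /\
    exists2 b, ideal_exp (ideal_gen [set` s]) j b & y = x ^+ i * b].
Proof.
elim: n => [|n IH].
  by move=> y _; apply: ideal_gen_sub; exists 0%N, 0%N; split=> //;
    exists y => //; rewrite mul1r.
apply: ideal_mul_min; first exact: ideal_gen_ideal.
move=> a c /ideal_gen_seq_cons[k sk [r ->]] /IH; set G := (X in _ -> X _).
have hG : is_ideal G by exact: ideal_gen_ideal.
rewrite mulrC; move: c.
apply: (ideal_gen_min (K := [set c | G (c * (k + r * x))])).
  exact: colon_ideal.
move=> _ [i [j [ijE [b sb ->]]]] /=.
have -> : x ^+ i * b * (k + r * x) = x ^+ i * (k * b) + r * (x ^+ i.+1 * b).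
  by rewrite exprS; ring.
apply: (ideal_addr hG).
  apply: ideal_gen_sub; exists i, j.+1; split; first by rewrite addnS ijE.
  by exists (k * b) => //; exact: ideal_mul_mem.
apply: (ideal_mull _ hG); apply: ideal_gen_sub; exists i.+1, j.
split; first by rewrite addSn ijE.
by exists b.
Qed.

(** By [ideal_exp_cons], elements of [(x, s) ^ (e + n)] are combinations of
    terms with either at least [e] factors [x] or at least [n] factors from
    [(s)]. *)
Lemma radical_exp_sub (s : seq R) K : is_ideal K ->
  [set` s] `<=` radical K -> exists n, ideal_exp (ideal_gen [set` s]) n `<=` K.
Proof.
move=> hK; elim: s => [|x s IH] sK.
  exists 1%N; rewrite ideal_exp1; last exact: ideal_gen_ideal.
  exact: ideal_gen_min.
have [y ys|n nK] := IH; first by apply: sK; rewrite /= inE ys orbT.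
have [|e eK] := sK x; first by rewrite /= mem_head.
exists (e + n)%N; apply: (subset_trans (ideal_exp_cons (n := _))).
apply: ideal_gen_min => // _ [i [j [ijE [b sb ->]]]].
have [ei|ie] := leqP e i.
  apply: ideal_mulr => //; rewrite -(subnK ei) exprD.
  exact: ideal_mull.
apply: ideal_mull => //; apply: nK; apply: ideal_exp_le sb.
by rewrite -(leq_add2l e) -ijE leq_add2r ltnW.
Qed.

(** In the binomial expansion each term has [a ^+ n] or [b ^+ f] as a
    factor. *)
Lemma ideal_exprD K a b t n f : is_ideal K -> t * b ^+ f = 0 -> K (a ^+ n) ->
  K (t * (a + b) ^+ (n + f)).
Proof.
move=> hK tb Ka; rewrite exprDn mulr_sumr.
elim/big_rec: _ => [|i y _ Ky]; first by case: hK.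
apply: ideal_addr => //; rewrite -mulrnAr -[_ *+ _]mulr_natr !mulrA.
apply: ideal_mulr => //.
have [fi|lt_fi] := leqP f i.
  rewrite -[X in b ^+ X](subnK fi) exprD.
  rewrite [X in K X](_ : _ = a ^+ (n + f - i) * b ^+ (i - f) * (t * b ^+ f)).
    by rewrite tb mulr0; case: hK.
  by ring.
apply: ideal_mulr => //; apply: ideal_mull => //.
have /subnK <- : (n <= n + f - i)%N by rewrite -addnBA ?leq_addr // ltnW.
by rewrite exprD; exact: ideal_mull.
Qed.

(** A weak form of the Artin-Rees lemma, by Noetherian induction: take [Q]
    maximal among the ideals that contain [m ^ k E] and have trace [m ^ k E] on
    [E].  If [x] is in [m] and the chain of the [(Q : x ^ j)] is constant from
    [j] on, then [Q + (x ^ j)] has the same trace, so [Q] contains [x ^ j];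
    hence [Q] contains a power of [m]. *)
Lemma weak_artin_rees E m k : noetherian R -> is_ideal E -> is_ideal m ->
  exists n, ideal_exp m n `&` E `<=` ideal_mul (ideal_exp m k) E.
Proof.
move=> noeth hE hm; set W := ideal_mul _ _.
have hW : is_ideal W by exact: ideal_mul_ideal.
pose F := [set Q | [/\ is_ideal Q, W `<=` Q & Q `&` E `<=` W]].
have [||Q [hQ WQ QE] Qmax] := @noetherian_max R F W noeth; first by move=> K [].
  by split=> // x [].
suff mQ : m `<=` radical Q.
  have [s ms] := noeth _ hm; rewrite ms in mQ *.
  have [|n nQ] := @radical_exp_sub s Q hQ.
    by apply: subset_trans mQ; exact: ideal_gen_sub.
  by exists n => x [/nQ Qx Ex]; exact: QE.
move=> x mx.
pose A j := [set y | Q (y * x ^+ j)].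
have [||_ [j ->] Amax] :=
    @noetherian_max R [set K | exists j, K = A j] (A 0%N) noeth.
- by move=> _ [j ->]; exact: colon_ideal.
- by exists 0%N.
have {}Amax y : Q (y * x ^+ (j + k)) -> Q (y * x ^+ j).
  suff -> : Q (y * x ^+ j) = A (j + k)%N y by [].
  rewrite (Amax (A (j + k)%N)) //; first by exists (j + k)%N.
  by move=> u; rewrite /A /= exprD mulrA; exact: ideal_mulr.
exists j; pose Q' := ideal_gen (Q `|` [set x ^+ j]).
have QQ' : Q `<=` Q' by move=> y Qy; apply: ideal_gen_sub; left.
rewrite -(Qmax Q') //; first by apply: ideal_gen_sub; right.
split; [exact: ideal_gen_ideal|exact: subset_trans QQ'|].
move=> y [Q'y Ey]; have [q Qq [r ye]] := ideal_gen_cons hQ Q'y.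
apply: QE; split=> //; rewrite ye; apply: ideal_addr => //; apply: Amax.
have -> : r * x ^+ (j + k) = x ^+ k * y - x ^+ k * q.
  by rewrite ye exprD; ring.
apply: ideal_subr => //; last exact: ideal_mull.
by apply: WQ; apply: ideal_mul_mem => //; exact: ideal_exp_mem.
Qed.

End Powers.

(** * Sequences converging to an ideal *)

Section AdicLimits.
Variables (R : comPzRingType) (m : set R).
Hypotheses (noeth : noetherian R) (hm : is_ideal m).
Implicit Types (N E F : set R) (b : nat -> R).

(** The terms of [b] are eventually [m]-adically close to [N]; the nearby
    elements of [N] may vary from term to term. *)
Definition tends_to N b := forall k, exists l, forall i, (l <= i)%N ->
  exists2 e, N e & ideal_exp m k (b i - e).

(** Let [b i * h = e + c] with [e] in [N] and [c] in a high power of [m].  Then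
    [c] is in [N + (h)], so by weak Artin-Rees it is [c' * h] modulo [N] with
    [c'] still in a high power of [m], and [b i - c'] is in [(N : h)]. *)
Lemma tends_to_colon N b h : is_ideal N ->
  tends_to N (fun i => b i * h) -> tends_to [set x | N (x * h)] b.
Proof.
move=> hN bh k; pose E := ideal_gen (N `|` [set h]).
have hE : is_ideal E by exact: ideal_gen_ideal.
have NE : N `<=` E by move=> x Nx; apply: ideal_gen_sub; left.
have Eh : E h by apply: ideal_gen_sub; right.
have [n nE] := weak_artin_rees k noeth hE hm.
have [l lb] := bh n; exists l => i /lb[e Ne be].
have /nE : (ideal_exp m n `&` E) (b i * h - e).
  by split=> //; apply: (ideal_subr hE); [exact: (ideal_mull _ hE)|exact: NE].
have hmk := ideal_exp_ideal m k.
pose K := [set x | exists2 c, ideal_exp m k c & N (x - c * h)].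
have hK : is_ideal K.
  split=> [|x y [c mc Nc] [d md Nd]|a x [c mc Nc]].
  - exists 0; first by case: hmk.
    by rewrite mul0r subr0; case: hN.
  - exists (c + d); first exact: ideal_addr.
    by rewrite mulrDl opprD addrACA; exact: ideal_addr.
  - exists (a * c); first exact: ideal_mull.
    by rewrite -mulrA -mulrBr; exact: ideal_mull.
have /[apply] : ideal_mul (ideal_exp m k) E `<=` K.
  apply: ideal_mul_min => // a y ma /(ideal_gen_cons hN)[x Nx [r ->]].
  exists (a * r); first exact: ideal_mulr.
  by rewrite mulrDr mulrA addrK; exact: ideal_mull.
case=> c mc Nc; exists (b i - c); last by rewrite opprB addrC subrK.
rewrite /= mulrBl.
have -> : b i * h - c * h = e + (b i * h - e - c * h) by ring.
exact: ideal_addr.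
Qed.

(** If [b i] is close to both [x] in [E] and [y] in [F], then [x - y] is in
    [m ^ n] and in [E + F], so by weak Artin-Rees it is a small element of [E]
    plus a small element of [F]. *)
Lemma tends_toI E F b : is_ideal E -> is_ideal F ->
  tends_to E b -> tends_to F b -> tends_to (E `&` F) b.
Proof.
move=> hE hF bE bF k; have hmk := ideal_exp_ideal m k.
pose EF := ideal_gen (E `|` F).
have hEF : is_ideal EF by exact: ideal_gen_ideal.
have [n nEF] := weak_artin_rees k noeth hEF hm.
have [l lE] := bE (maxn n k); have [l' lF] := bF (maxn n k).
exists (maxn l l') => i; rewrite geq_max => /andP[/lE[x Ex bx] /lF[y Fy bY]].
have mn z : ideal_exp m (maxn n k) z -> ideal_exp m n z.
  by apply: ideal_exp_le; exact: leq_maxl.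
have mk z : ideal_exp m (maxn n k) z -> ideal_exp m k z.
  by apply: ideal_exp_le; exact: leq_maxr.
have /nEF : (ideal_exp m n `&` EF) (x - y).
  split.
    have -> : x - y = (b i - y) - (b i - x) by ring.
    by apply: ideal_subr; [exact: ideal_exp_ideal|exact: mn|exact: mn].
  by apply: (ideal_subr hEF); apply: ideal_gen_sub; [left|right].
pose K := [set z | exists2 u, ideal_exp m k u /\ E u & F (z - u)
  /\ ideal_exp m k (z - u)].
have hK : is_ideal K.
  split=> [|z w [u [mu Eu] [Fu mzu]] [v [mv Ev] [Fv mwv]]
    |a z [u [mu Eu] [Fu mzu]]].
  - exists 0; first by split; [case: hmk|case: hE].
    by rewrite subr0; split; [case: hF|case: hmk].
  - exists (u + v); first by split; exact: ideal_addr.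
    by rewrite opprD addrACA; split; exact: ideal_addr.
  - exists (a * u); first by split; exact: ideal_mull.
    by rewrite -mulrBr; split; exact: ideal_mull.
have /[apply] : ideal_mul (ideal_exp m k) EF `<=` K.
  apply: ideal_mul_min => // a z ma.
  rewrite mulrC; apply: (ideal_gen_min (K := [set z | K (z * a)])).
    exact: colon_ideal.
  move=> {}z [Ez|Fz] /=.
    exists (z * a); first by split; [exact: ideal_mull|exact: ideal_mulr].
    by rewrite subrr; split; [case: hF|case: hmk].
  exists 0; first by split; [case: hmk|case: hE].
  by rewrite subr0; split; [exact: ideal_mulr|exact: ideal_mull].
case=> u [mu Eu] [Fu mxyu]; exists (x - u).
  split; first exact: ideal_subr.
  by have -> : x - u = y + (x - y - u) by [ring]; exact: ideal_addr.
have -> : b i - (x - u) = (b i - x) + u by ring.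
by apply: ideal_addr => //; exact: mk.
Qed.

(** When [(N : m) = N], the ideal [N] is the intersection of the [(N : g)] for
    [g] in a finite generating set of [m], so the two previous lemmas remove
    one factor of [m] at a time. *)
Lemma tends_to_saturated N b n : is_ideal N ->
  (forall a, (forall g, m g -> N (a * g)) -> N a) ->
  (forall h, ideal_exp m n h -> tends_to N (fun i => b i * h)) ->
  tends_to N b.
Proof.
move=> hN sat; have [s ms] := noeth hm.
have step c : (forall g, m g -> tends_to N (fun i => c i * g)) -> tends_to N c.
  move=> mc.
  (* the intersection of the colon ideals of the generators, one at a time *)
  suff inter (t : seq R) : {subset t <= s} ->
      tends_to [set x | forall g, g \in t -> N (x * g)] c.
    move=> k; have [l lc] := inter s (fun _ => id) k.
    exists l => i /lc[e Ne ce]; exists e => //; apply: sat => g.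
    rewrite ms; apply: (ideal_gen_min (K := [set g | N (e * g)])).
      under eq_set do rewrite mulrC.
      exact: colon_ideal.
    by move=> h /Ne.
  elim: t => [_ k|g t IH ts].
    exists 0%N => i _; exists (c i) => //; rewrite subrr.
    by case: (ideal_exp_ideal m k).
  have -> : [set x | forall h, h \in g :: t -> N (x * h)] =
      [set x | N (x * g)] `&` [set x | forall h, h \in t -> N (x * h)].
    apply/seteqP; split=> x /= h.
      split=> [|f ft]; apply: h; first exact: mem_head.
      by rewrite inE ft orbT.
    by case: h => hg ht f; rewrite inE => /orP[/eqP->//|/ht].
  apply: tends_toI.
  - exact: colon_ideal.
  - split=> [h _|x y hx hy h ht|a x hx h ht].
    + by rewrite mul0r; case: hN.
    + by rewrite mulrDl; apply: ideal_addr => //; [exact: hx|exact: hy].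
    + by rewrite -mulrA; apply: ideal_mull => //; exact: hx.
  - apply: tends_to_colon => //; apply: mc; rewrite ms; apply: ideal_gen_sub.
    by apply: ts; rewrite mem_head.
  - by apply: IH => h ht; apply: ts; rewrite inE ht orbT.
elim: n b => [|n IH] b mb.
  suff <- : (fun i => b i * 1) = b by exact: mb.
  by apply/funext => i; rewrite mulr1.
apply: IH => h mh; apply: step => g mg.
suff -> : (fun i => b i * h * g) = (fun i => b i * (g * h)).
  by apply: mb; exact: ideal_mul_mem.
by apply/funext => i; rewrite -mulrA [h * g]mulrC.
Qed.

End AdicLimits.

(** * Extension of ideals *)

Section Extension.
Variables (R B : comPzRingType) (f : {rmorphism R -> B}).
Implicit Types (I J : set R).

Lemma ideal_ext_ideal I : is_ideal (ideal_ext f I).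
Proof. exact: ideal_gen_ideal. Qed.

Lemma ideal_ext_mem I x : I x -> ideal_ext f I (f x).
Proof. by move=> Ix; apply: ideal_gen_sub; exists x. Qed.

Lemma ideal_ext_min I K : is_ideal K -> (forall x, I x -> K (f x)) ->
  ideal_ext f I `<=` K.
Proof. by move=> hK IK; apply: ideal_gen_min => // _ [x Ix <-]; exact: IK. Qed.

Lemma preimage_ideal K : is_ideal K -> is_ideal (f @^-1` K).
Proof.
move=> hK; split=> [|x y Kx Ky|a x Kx] /=.
- by rewrite rmorph0; case: hK.
- by rewrite rmorphD; exact: ideal_addr.
- by rewrite rmorphM; exact: ideal_mull.
Qed.

Lemma preimage_prime q : is_prime q -> is_prime (f @^-1` q).
Proof.
case=> hq qT qM; split; first exact: preimage_ideal.
  move=> e; apply: (ideal_proper1 hq qT); rewrite -(rmorph1 f).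
  by have : (f @^-1` q) 1 by rewrite e.
by move=> x y; rewrite /preimage /= rmorphM; exact: qM.
Qed.

Lemma ideal_ext_gen X : ideal_ext f (ideal_gen X) = ideal_gen (f @` X).
Proof.
apply/seteqP; split.
  apply: ideal_ext_min; first exact: ideal_gen_ideal.
  apply: ideal_gen_min.
    by apply: preimage_ideal; exact: ideal_gen_ideal.
  by move=> x Xx; apply: ideal_gen_sub; exists x.
by apply: ideal_genS; apply: image_subset; exact: ideal_gen_sub.
Qed.

Lemma ideal_ext_adjoin I (xs : seq R) :
  ideal_ext f (ideal_adjoin I xs) = ideal_adjoin (ideal_ext f I) (map f xs).
Proof.
rewrite ideal_ext_gen image_setU; apply/seteqP; split.
  apply: ideal_gen_min; first exact: ideal_gen_ideal.
  move=> x [Ix|[y ys <-]]; apply: ideal_gen_sub.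
    by left; apply: ideal_gen_sub.
  by right; rewrite /= map_f.
apply: ideal_gen_min; first exact: ideal_gen_ideal.
move=> x [|/mapP[y ys ->]]; last by apply: ideal_gen_sub; right; exists y.
by apply: ideal_genS => y; left.
Qed.

Lemma ideal_ext_mul I J :
  ideal_ext f (ideal_mul I J) = ideal_mul (ideal_ext f I) (ideal_ext f J).
Proof.
rewrite [LHS]ideal_ext_gen; apply/seteqP; split.
  apply: ideal_gen_min; first exact: ideal_mul_ideal.
  move=> _ [_ [a Ia [b Jb ->]] <-]; rewrite rmorphM.
  by apply: ideal_mul_mem; exact: ideal_ext_mem.
set K := ideal_gen _; have hK : is_ideal K by exact: ideal_gen_ideal.
apply: (ideal_mul_min hK) => a b Ia Jb; move: a Ia.
apply: (ideal_gen_min (K := [set a | K (a * b)])); first exact: colon_ideal.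
move=> _ [x Ix <-] /=; rewrite mulrC; move: b Jb.
apply: (ideal_gen_min (K := [set b | K (b * f x)])); first exact: colon_ideal.
move=> _ [y Jy <-] /=; rewrite mulrC -rmorphM; apply: ideal_gen_sub.
by exists (x * y) => //; exists x => //; exists y.
Qed.

Lemma ideal_ext_exp J n :
  ideal_ext f (ideal_exp J n) = ideal_exp (ideal_ext f J) n.
Proof.
elim: n => [|n IH].
  apply: ideal_eqT; first exact: ideal_ext_ideal.
  by rewrite -(rmorph1 f); exact: ideal_ext_mem.
by rewrite [LHS]ideal_ext_mul IH.
Qed.

End Extension.

Lemma ideal_ext_comp (R B C : comPzRingType) (f : {rmorphism R -> B})
  (g : {rmorphism B -> C}) (I : set R) :
  ideal_ext (g \o f) I = ideal_ext g (ideal_ext f I).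
Proof. by rewrite ideal_ext_gen image_comp. Qed.

(** * Completion *)

Local Coercion Completion.component : Completion.compl >-> Funclass.

Section Completion.
Variables (B : comPzRingType) (m : set B).
Hypothesis hm : is_ideal m.
Notation C := (completion m).
Notation cm := (completion_map m).
Implicit Types (E N : set B).

Lemma proj_eq k (a b : B) :
  RingQuot.proj (ideal_exp m k) a = RingQuot.proj (ideal_exp m k) b
    :> Completion.layer m k <->
  ideal_exp m k (a - b).
Proof.
rewrite /RingQuot.proj RingQuot.eq_quotP ideal_gen_id //.
exact: ideal_exp_ideal.
Qed.

Lemma component_lift (x : C) k l b : (k <= l)%N ->
  x l = RingQuot.proj (ideal_exp m l) b ->
  x k = RingQuot.proj (ideal_exp m k) b.
Proof.
move=> /subnK <-; elim: (l - k)%N => // n IH e; apply: IH.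
by rewrite -(Completion.componentP x) -Completion.transition_proj -e.
Qed.

Lemma completion_ext_component N y k : is_ideal N ->
  ideal_ext cm N y -> exists2 e, N e & y k = RingQuot.proj (ideal_exp m k) e.
Proof.
move=> hN; apply: (ideal_ext_min
  (K := [set y : C | exists2 e, N e & y k = RingQuot.proj (ideal_exp m k) e])).
  split=> [|u v [e Ne ue] [g Ng vg]|a u [e Ne ue]].
  - exists 0; first by case: hN.
    by rewrite rmorph0.
  - exists (e + g); first exact: ideal_addr.
    by rewrite rmorphD /= -ue -vg.
  - have [c ac] := Completion.layer_surj (a k).
    by exists (c * e); [exact: ideal_mull|rewrite rmorphM /= -ue -ac].
by move=> x Nx; exists x.
Qed.

(** The first component lives in [B / m]. *)
Lemma completion_ext_contract x : ideal_ext cm m (cm x) -> m x.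
Proof.
move=> /(completion_ext_component 1 hm)[e me] /(proj_eq 1 x e).
rewrite ideal_exp1 // => h; rewrite -(subrK e x).
exact: ideal_addr.
Qed.

(** With [B = R_p], [m = p R_p] and [E = I R_p], the condition for [p] to be a
    quintasymptotic prime of [I].  For an arbitrary pair [(B, m)] it can be
    transported along isomorphisms. *)
Definition local_quintasymptotic E := exists2 z : set C, is_minimal_prime z &
  radical (ideal_gen (ideal_ext cm E `|` z)) = ideal_ext cm m.

Lemma local_quintasymptotic_sub E : local_quintasymptotic E -> E `<=` m.
Proof.
move=> [z _ rad] x Ex; apply: completion_ext_contract; rewrite -rad.
exists 1%N; rewrite expr1; apply: ideal_gen_sub; left.
exact: ideal_ext_mem.
Qed.

(** Elements of [m] have powers in [E C + z]; the part in [z] is killed, up to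
    a power, by some [s] outside [z], and one [s] serves all generators of
    [m].  So for all [n], a power of [m] multiplies [s] into [E ^ n C]. *)
Lemma local_quintasymptotic_multiplier E : noetherian B -> is_ideal E ->
  local_quintasymptotic E ->
  exists2 s : C, s <> 0 & forall n, exists l, forall h, ideal_exp m l h ->
    ideal_ext cm (ideal_exp E n) (s * cm h).
Proof.
move=> noeth hE [z [zp zmin] rad]; have [gs mgs] := noeth _ hm.
have [z1 zM] := prime_mul_closed zp.
have [s zs sN] : exists2 s, ~ z s & forall g, g \in gs -> forall n, exists e,
    ideal_ext cm (ideal_exp E n) (s * cm g ^+ e).
  have : {in gs, forall g, m g}.
    by move=> g gg; rewrite mgs; exact: ideal_gen_sub.
  elim: gs {mgs} => [_|g gs IH mgs]; first by exists 1.
  have [h hgs|s zs sN] := IH; first by apply: mgs; rewrite inE hgs orbT.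
  have : ideal_ext cm m (cm g).
    by apply: ideal_ext_mem; apply: mgs; exact: mem_head.
  rewrite -rad => -[d] /(ideal_gen_setU (ideal_ext_ideal _ _) (prime_ideal zp)).
  move=> [a Ea [b zb gab]].
  have [t zt [f tb]] := minimal_prime_nilpotent (conj zp zmin) zb.
  (* [t] kills a power of [b], so in [s * t * (a + b) ^+ (n + f)] only the
     terms divisible by [a ^+ n] survive *)
  exists (s * t); first exact: zM.
  move=> h hgs n; have hEn := ideal_ext_ideal cm (ideal_exp E n).
  move: hgs; rewrite inE => /orP[/eqP->|/sN/(_ n)[e he]]; last first.
    by exists e; rewrite mulrAC; exact: (ideal_mulr _ hEn).
  exists (d * (n + f))%N; rewrite exprM gab -mulrA; apply: (ideal_mull _ hEn).
  apply: (ideal_exprD hEn tb); rewrite ideal_ext_exp.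
  exact: ideal_exp_mem.
exists s; first by move=> s0; apply: zs; rewrite s0; case: (prime_ideal zp).
move=> n; pose K := [set h | ideal_ext cm (ideal_exp E n) (s * cm h)].
have hK : is_ideal K.
  have hEn := ideal_ext_ideal cm (ideal_exp E n).
  split=> [|x y Kx Ky|a x Kx]; rewrite /K /=.
  - by rewrite rmorph0 mulr0; case: hEn.
  - by rewrite rmorphD mulrDr; exact: (ideal_addr hEn).
  - by rewrite rmorphM mulrCA; exact: (ideal_mull _ hEn).
have [|l lK] := @radical_exp_sub _ gs K hK.
  by move=> g /sN/(_ n)[e he]; exists e; rewrite /K /= rmorphXn.
exists l => h mh; apply: (lK h); rewrite -mgs; exact: mh.
Qed.

(** If every [E ^ n] were saturated, the multiplier [s] would have components
    arbitrarily close to every [E ^ n], hence zero, because [E] is in [m]. *)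
Lemma local_quintasymptotic_ass E : noetherian B -> is_ideal E ->
  local_quintasymptotic E ->
  exists n a, ~ ideal_exp E n a /\ forall g, m g -> ideal_exp E n (a * g).
Proof.
move=> noeth hE qE; have Em := local_quintasymptotic_sub qE.
have [s s0 sE] := local_quintasymptotic_multiplier noeth hE qE.
apply: contrapT => noass; apply: s0; apply: Completion.complP => k.
pose b i := repr (s i).
have sb i : s i = RingQuot.proj (ideal_exp m i) (b i).
  by rewrite /RingQuot.proj reprK.
have hEn n := ideal_exp_ideal E n.
(* [E ^ k] is in [m ^ k], so closeness to [E ^ k] already kills [s k] *)
have [l lE] := sE k.
have /(_ k)[i bi] : tends_to m (ideal_exp E k) b.
  apply: (@tends_to_saturated _ _ noeth hm _ _ l (hEn k)) => [a ma|h mh j].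
    by apply: contrapT => na; apply: noass; exists k, a.
  exists j => i ji.
  have [e Ee] := completion_ext_component i (hEn k) (lE _ mh).
  have -> : (s * cm h) i = RingQuot.proj (ideal_exp m i) (b i * h).
    by rewrite rmorphM /= -sb.
  by move=> /(proj_eq i (b i * h) e) be; exists e => //; exact: ideal_exp_le be.
have [//|e Ee be] := bi (maxn i k); first exact: leq_maxl.
rewrite (component_lift (leq_maxr i k) (sb _)).
transitivity (RingQuot.proj (ideal_exp m k) 0); last by rewrite rmorph0.
apply/(proj_eq k _ 0); rewrite subr0 -(subrK e (b _)).
apply: ideal_addr => //; first exact: ideal_exp_ideal.
exact: ideal_exp_mono Ee.
Qed.

End Completion.

(** * Hilbert's basis theorem and the Rees algebra *)

(** The family [v] is kept so that generators of coefficient ideals come with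
    polynomials having these coefficients. *)
Lemma noetherian_finite_image (B : comPzRingType) (T : eqType) (Y : set T)
    (v : T -> B) : noetherian B ->
  exists t : seq T, [set` t] `<=` Y /\
    forall y, Y y -> ideal_gen (v @` [set` t]) (v y).
Proof.
move=> noeth.
pose F := [set K | exists2 t : seq T, [set` t] `<=` Y
  & K = ideal_gen (v @` [set` t])].
have [||_ [t tY ->] tmax] :=
    @noetherian_max B F (ideal_gen (v @` [set` [::]])) noeth.
- by move=> _ [t _ ->]; exact: ideal_gen_ideal.
- by exists [::].
exists t; split=> // y Yy; rewrite -(tmax (ideal_gen (v @` [set` y :: t]))).
- by apply: ideal_gen_sub; exists y => //; rewrite /= mem_head.
- exists (y :: t) => // z; rewrite /= inE => /orP[/eqP->//|zt]; exact: tY.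
- apply: ideal_genS => _ [z zt <-]; exists z => //.
  by rewrite /= inE zt orbT.
Qed.

(** Generators of an ideal [E] of polynomials: finitely many whose leading
    coefficients generate all the leading coefficients of [E], and, for each
    of the finitely many degrees below theirs, finitely many that do so in
    that degree. *)
Lemma hilbert_basis (B : comNzRingType) : noetherian B -> noetherian {poly B}.
Proof.
move=> noeth E hE.
have [t [tE tlead]] := noetherian_finite_image E lead_coef noeth.
pose D := \max_(h <- t) size h.
have /choice[u uP] d := noetherian_finite_image
  [set f : {poly B} | E f /\ (size f <= d.+1)%N] (fun f => f`_d) noeth.
pose s := t ++ flatten [seq u d | d <- iota 0 D].
exists s; set G := ideal_gen _.
have hG : is_ideal G by exact: ideal_gen_ideal.
have GE : G `<=` E.
  apply: ideal_gen_min => // g; rewrite /= mem_cat => /orP[/tE//|].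
  by move=> /flattenP[_ /mapP[d _ ->]] /(uP d).1[].
apply/seteqP; split=> // f; move: {2}(size f) (leqnn (size f)) => n.
elim: n f => [|n IH] f.
  by rewrite leqn0 size_poly_eq0 => /eqP-> _; case: hG.
move=> sf Ef.
suff [g Gg [sg gf]] : exists2 g, G g & (size g <= n.+1)%N /\ g`_n = f`_n.
  rewrite -(subrK g f); apply: (ideal_addr hG) => //; apply: IH.
    apply/leq_sizeP => j; rewrite leq_eqVlt => /orP[/eqP<-|nj].
      by rewrite coefB gf subrr.
    by rewrite coefB !nth_default ?subrr // (leq_trans _ nj).
  by apply: ideal_subr => //; exact: GE.
pose L := [set c | exists2 g, G g & (size g <= n.+1)%N /\ g`_n = c].
have hL : is_ideal L.
  split=> [|_ _ [g Gg [sg <-]] [h Gh [sh <-]]|a _ [g Gg [sg <-]]].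
  - by exists 0; [case: hG|rewrite size_poly0 coef0].
  - exists (g + h); first exact: (ideal_addr hG).
    by rewrite coefD (leq_trans (size_polyD _ _)) // geq_max sg.
  - exists (a%:P * g); first exact: (ideal_mull _ hG).
    by rewrite mul_polyC coefZ (leq_trans (size_scale_leq _ _)).
have sG h : h \in s -> G h by move=> hs; exact: ideal_gen_sub.
have [nD|Dn] := ltnP n D.
  have := (uP n).2 f (conj Ef sf); apply: (ideal_gen_min hL).
  move=> _ [g gu <-]; exists g; last by split=> //; case: ((uP n).1 g gu).
  apply: sG; rewrite mem_cat; apply/orP; right; apply/flattenP.
  by exists (u n) => //; apply: map_f; rewrite mem_iota.
have [lt_fn|ge_fn] := leqP (size f) n.
  by exists 0; [case: hG|rewrite size_poly0 coef0 nth_default].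
have <- : lead_coef f = f`_n.
  rewrite lead_coefE; congr (_`_ _); apply/eqP.
  by rewrite -eqSS prednK ?(leq_trans _ ge_fn) // eqn_leq sf.
have := tlead f Ef; apply: (ideal_gen_min hL) => _ [h ht <-].
have sh : (size h <= n)%N.
  by apply: leq_trans Dn; rewrite /D (big_rem h) //= leq_maxl.
have [->|h0] := eqVneq h 0.
  by rewrite lead_coef0; case: hL.
exists (h * 'X^(n.+1 - size h)).
  by apply: (ideal_mulr _ hG); apply: sG; rewrite mem_cat ht.
have h1 : (0 < size h)%N by rewrite size_poly_gt0.
rewrite size_mulXn // (subnK (leqW sh)); split=> //.
rewrite coefMXn lead_coefE; case: (size h) h1 sh => // k _ kn.
by rewrite subSS ltnNge leq_subr /= subKn // ltnW.
Qed.

(** When [s] generates [J], the image of [phi] is the Rees algebra of [J], the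
    ring of polynomials whose [i]-th coefficient is in [J ^ i].  The ring [B] is
    a polynomial ring over [R] with one variable for each [g] in [s], which
    [phi] sends to [g *: 'X]. *)
Lemma rees_presentation (R : comNzRingType) (J : set R) (s : seq R) :
  noetherian R -> is_ideal J -> [set` s] `<=` J ->
  exists (B : comNzRingType) (iota : {rmorphism R -> B})
    (phi : {rmorphism B -> {poly R}}),
  [/\ noetherian B, forall r, phi (iota r) = r%:P,
      forall g, g \in s -> exists b, phi b = g *: 'X
    & forall b i, ideal_exp J i (phi b)`_i].
Proof.
move=> noeth hJ; elim: s => [_|g s IH sJ].
  exists R, idfun, polyC; split=> // b i; rewrite coefC.
  by case: eqP => [->//|_]; case: (ideal_exp_ideal J i).
have [h hs|B [iota [phi [Bnoeth phiC phiX phiJ]]]] := IH.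
  by apply: sJ; rewrite /= inE hs orbT.
have cphi : commr_rmorph phi (g *: 'X) by move=> b; exact: mulrC.
exists {poly B}, (polyC \o iota), (horner_morph cphi); split.
- exact: hilbert_basis.
- by move=> r; rewrite /= horner_morphC phiC.
- move=> h; rewrite inE => /orP[/eqP->|/phiX[b bh]].
    by exists 'X; rewrite /= horner_morphX.
  by exists b%:P; rewrite /= horner_morphC.
- elim/poly_ind => [|q c IHq] i.
    by rewrite rmorph0 coef0; case: (ideal_exp_ideal J i).
  rewrite rmorphD rmorphM /= horner_morphX horner_morphC coefD.
  have hJi := ideal_exp_ideal J i.
  apply: ideal_addr => //; rewrite -scalerAr coefZ coefMX.
  case: i hJi => [//|i] hJi /=.
  by apply: ideal_mul_mem => //; apply: sJ; rewrite /= mem_head.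
Qed.

(** * Finiteness of the associated primes of the powers of an ideal *)

(** Noetherian induction on a counterexample [K].  Take [P = (K : g)] prime and
    pass to [K + (g)].  If the trace on [R] of [(K : f)] is a prime that changes
    in doing so, then a multiple of [f] by an element of [R] is in [K + (g)] but
    not in [K]; it is a multiple of [g] modulo [K], and the trace is that of
    [P]. *)
Lemma finite_associated_primes (R B : comPzRingType) (iota : {rmorphism R -> B})
    (K : set B) : noetherian B -> is_ideal K ->
  exists F : seq (set R), forall (p : set R) f, is_prime p ->
    p = iota @^-1` [set x | K (x * f)] -> p \in F.
Proof.
move=> noeth hK; apply: contrapT => Kbad.
pose good K := exists F : seq (set R), forall (p : set R) f, is_prime p ->
    p = iota @^-1` [set x | K (x * f)] -> p \in F.
have [|//|{hK Kbad}K [hK Kbad] Kmax] :=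
  @noetherian_max B [set K | is_ideal K /\ ~ good K] K noeth.
  by move=> ? [].
apply: Kbad; have [K1|K1] := pselect (K 1).
  exists [::] => p f [_ pT _] pE; case: pT; rewrite pE; apply/seteqP.
  by split=> // x _; rewrite /preimage /= (ideal_eqT hK K1).
(* an annihilator maximal among those of the elements outside [K] is prime *)
have [||P [g [Kg PE]] Pmax] := @noetherian_max B
  [set P | exists g, ~ K g /\ P = [set x | K (x * g)]]
  [set x | K (x * 1)] noeth.
- by move=> _ [g [_ ->]]; exact: colon_ideal.
- by exists 1.
have PM x y : P (x * y) -> P x \/ P y.
  have [Px|Px] := pselect (P x); first by left.
  move=> Pxy; right; rewrite -(Pmax [set y | K (y * (x * g))]) /=.
  - by move: Pxy; rewrite PE /= mulrA [y * x]mulrC.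
  - by exists (x * g); split=> //; move: Px; rewrite PE.
  - by move=> z; rewrite PE /= mulrCA; exact: ideal_mull.
pose K' := ideal_gen (K `|` [set g]).
have hK' : is_ideal K' by exact: ideal_gen_ideal.
have KK' : K `<=` K' by move=> x Kx; apply: ideal_gen_sub; left.
have [F FP] : good K'.
  apply: contrapT => bad; apply: Kg; rewrite -(Kmax K') //.
  by apply: ideal_gen_sub; right.
exists (iota @^-1` P :: F) => p f pp pE; rewrite inE.
have [_ _ pM] := pp.
have [[b [K'b Kb]]|nob] :=
    pselect (exists b, K' (iota b * f) /\ ~ K (iota b * f)).
  apply/orP; left; apply/eqP.
  have pb : ~ p b by rewrite pE.
  have [k Kk [c bf]] := ideal_gen_cons hK K'b.
  have Pc : ~ P c by rewrite PE => Pc; apply: Kb; rewrite bf; exact: ideal_addr.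
  have cross x : K (iota (x * b) * f) <-> P (iota x * c).
    rewrite rmorphM -mulrA bf PE /= -mulrA mulrDr; split=> h.
      rewrite -[X in K X](addKr (iota x * k)); apply: ideal_addr => //.
      by apply: ideal_oppr => //; exact: ideal_mull.
    by apply: ideal_addr => //; exact: ideal_mull.
  apply/seteqP; split=> x px.
    have /cross/PM[//|//] : K (iota (x * b) * f).
    rewrite rmorphM mulrAC; apply: ideal_mulr => //.
    by move: px; rewrite pE.
  suff /pM[//|//] : p (x * b).
  rewrite pE; apply/cross; rewrite mulrC PE /= -mulrA.
  by apply: ideal_mull => //; move: px; rewrite PE.
apply/orP; right; apply: (FP p f) => //; rewrite pE.
apply/seteqP; split=> x; first exact: KK'.
by move=> K'x; apply: contrapT => Kx; apply: nob; exists x.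
Qed.

(** The primes [(J ^ n : a)] are the [(J ^ k.+1 : a)] with [a] in [J ^ k],
    and these are traces of annihilators in the Rees algebra modulo its ideal
    of the polynomials whose [i]-th coefficient is in [J ^ i.+1]. *)
Lemma finite_associated_primes_powers (R : comNzRingType) (J : set R) :
  noetherian R -> is_ideal J ->
  exists F : seq (set R), forall (p : set R) n a, is_prime p ->
    p = [set x | ideal_exp J n (x * a)] -> p \in F.
Proof.
move=> noeth hJ; have [s Js] := noeth _ hJ.
have [|B [iota [phi [Bnoeth phiC phiX phiJ]]]] :=
    @rees_presentation R J s noeth hJ.
  by rewrite Js; exact: ideal_gen_sub.
have hJn n := ideal_exp_ideal J n.
have surj n a : ideal_exp J n a -> exists b, phi b = a *: 'X^n.
  have him k : is_ideal [set a | exists b, phi b = a *: 'X^k].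
    split=> [|x y [b bx] [c cy]|r x [b bx]].
    - by exists 0; rewrite rmorph0 scale0r.
    - by exists (b + c); rewrite rmorphD /= bx cy scalerDl.
    - by exists (iota r * b); rewrite rmorphM /= phiC bx mul_polyC scalerA.
  elim: n a => [|n IH].
    by move=> a _; exists (iota a); rewrite phiC expr0 alg_polyC.
  apply: (ideal_mul_min (him n.+1)) => x y Jx /IH[c cy].
  suff [b bx] : exists b, phi b = x *: 'X.
    exists (b * c).
    by rewrite rmorphM /= bx cy -scalerAl -scalerAr -exprS scalerA.
  move: Jx; rewrite Js; move: x.
  apply: (ideal_gen_min (him 1%N)) => x xs; exact: phiX.
(* the presented Rees algebra modulo [K] is the associated graded ring *)
pose K := [set b : B | forall i, ideal_exp J i.+1 (phi b)`_i].
have hK : is_ideal K.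
  split=> [i|b c Kb Kc i|b c Kc i].
  - by rewrite rmorph0 coef0; case: (hJn i.+1).
  - by rewrite rmorphD coefD; exact: ideal_addr (hJn _) (Kb i) (Kc i).
  - rewrite rmorphM coefM; elim/big_rec: _ => [|j y _ Jy].
      by case: (hJn i.+1).
    apply: (ideal_addr (hJn _)) => //.
    have := ideal_exp_add (phiJ b j) (Kc (i - j)%N).
    by rewrite addnS subnKC // -ltnS.
have [F FP] := finite_associated_primes iota Bnoeth hK.
exists F => p n a pp; elim: n a => [|n IH] a pE.
  by case: pp => _ []; rewrite pE; apply/seteqP; split.
(* if [a] is not in [J ^ n], either [p] is already [(J ^ n : a)] or a multiple
   of [a] by some [b] outside [p] is in [J ^ n] and has the same colon ideal *)
have [Ja|Ja] := pselect (ideal_exp J n a).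
  have [f fa] := surj _ _ Ja; apply: (FP p f) => //; rewrite pE.
  apply/seteqP; split=> x.
    move=> Jxa i; rewrite rmorphM phiC fa mul_polyC scalerA coefZ coefXn.
    case: eqP => [->|_]; first by rewrite mulr1.
    by rewrite mulr0; case: (hJn i.+1).
  move=> /(_ n); rewrite rmorphM phiC fa mul_polyC scalerA coefZ coefXn eqxx.
  by rewrite mulr1.
have [eq|] := pselect (p = [set x | ideal_exp J n (x * a)]); first exact: IH eq.
move=> neq; have [b [Jb pb]] : exists b, ideal_exp J n (b * a) /\ ~ p b.
  apply: contrapT => nob; apply: neq; apply/seteqP; split=> x.
    by rewrite {1}pE; exact: (ideal_exp_le (leqnSn n)).
  by move=> Jx; apply: contrapT => px; apply: nob; exists x.
have [f fa] := surj _ _ Jb; apply: (FP p f) => //.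
have [_ _ pM] := pp.
have cross x : p x <-> ideal_exp J n.+1 (x * (b * a)).
  split=> [px|Jx].
    by rewrite mulrCA; apply: ideal_mull (hJn _) _; move: px; rewrite pE.
  suff /pM[//|//] : p (x * b).
  by rewrite pE /= -mulrA.
apply/seteqP; split=> x.
  move=> /cross Jxa i; rewrite rmorphM phiC fa mul_polyC scalerA coefZ coefXn.
  case: eqP => [->|_]; first by rewrite mulr1.
  by rewrite mulr0; case: (hJn i.+1).
move=> /(_ n); rewrite rmorphM phiC fa mul_polyC scalerA coefZ coefXn eqxx.
by rewrite mulr1 => /cross.
Qed.

(** If [y] avoids [F] but lies in [p], add to it an element that lies in [I]
    and in all the primes of [F] but not in [p].  A product provides one unless
    [p] contains some [q] of [F], and then [q] may be dropped. *)
Lemma prime_avoidance (R : comPzRingType) (I : set R) (F : seq (set R)) :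
  is_ideal I -> {in F, forall p, is_prime p /\ ~ I `<=` p} ->
  exists2 x, I x & {in F, forall p : set R, ~ p x}.
Proof.
move=> hI; move: {2}(size F) (leqnn (size F)) => n; elim: n F => [|n IH] F.
  rewrite leqn0 => /eqP/size0nil -> _; exists 0 => //.
  by case: hI.
case: F => [|p F] sF Fp; first by apply: IH.
have FpF q : q \in F -> is_prime q /\ ~ I `<=` q.
  by move=> qF; apply: Fp; rewrite inE qF orbT.
have [[q qF qp]|noq] := pselect (exists2 q, q \in F & q `<=` p).
  have [|r|x Ix xF] := IH (p :: rem q F).
  - by rewrite /= size_rem // prednK //; case: (F) qF.
  - by rewrite inE => /orP[/eqP->|/mem_rem/FpF//]; apply: Fp; rewrite mem_head.
  exists x => // r; have px : ~ p x by apply: xF; rewrite mem_head.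
  rewrite inE => /orP[/eqP->//|rF].
  have [-> /qp//|rq] := eqVneq r q.
  apply: xF; rewrite inE; move: rF.
  by rewrite (perm_mem (perm_to_rem qF)) inE (negPf rq) /= => ->; rewrite orbT.
have [//|y Iy yF] := IH F _ FpF.
have [py|py] := pselect (p y); last first.
  by exists y => // q; rewrite inE => /orP[/eqP->//|]; exact: yF.
have [pp Ip] := Fp p (mem_head _ _); have [_ pM] := prime_mul_closed pp.
have [z [Iz pz] zF] : exists2 z, I z /\ ~ p z & {in F, forall q : set R, q z}.
  have : {subset F <= F} by [].
  elim: {1 3}F => [_|q G IHG GF].
    by move/existsNP: Ip => [z /not_implyP[Iz pz]]; exists z.
  have [r rG|z [Iz pz] zG] := IHG; first by apply: GF; rewrite inE rG orbT.
  have qF : q \in F by apply: GF; rewrite mem_head.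
  have [c qc pc] : exists2 c, q c & ~ p c.
    apply: contrapT => noc; apply: noq; exists q => // c qc.
    by apply: contrapT => pc; apply: noc; exists c.
  exists (c * z); first by split; [exact: ideal_mull|exact: pM].
  move=> r rG; have hr : is_prime r by case: (FpF r (GF r rG)).
  move: rG; rewrite inE => /orP[/eqP rq|/zG rz].
    by apply: ideal_mulr; [exact: prime_ideal|rewrite rq].
  by apply: ideal_mull => //; exact: prime_ideal.
exists (y + z); first exact: ideal_addr.
move=> q; rewrite inE => /orP[/eqP->|qF] qyz.
  apply: pz; rewrite -(addKr y z); apply: ideal_addr (prime_ideal pp) _ qyz.
  exact: ideal_oppr (prime_ideal pp) py.
have hq : is_ideal q by case: (FpF q qF) => /prime_ideal.
apply: (yF q qF); rewrite -(addrK z y).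
by apply: ideal_subr => //; exact: zF.
Qed.

(** * Localization *)

Section Localization.
Variables (R : comPzRingType) (S : set R).
Notation L := (localization S).
Notation M := (mul_gen S).
Implicit Types (I : set R).

Let SM s t : M s -> M t -> M (s * t).
Proof. exact: (mul_gen_closed S).2. Qed.

Let loc_piM (x z : Localization.frac S) :
  \pi_L x * \pi_L z = \pi_L (Localization.mulf x z) :> L.
Proof. by rewrite Localization.pi_mul. Qed.

Lemma loc_map_eq (a b : R) : loc_map S a = loc_map S b <->
  exists2 u, M u & u * a = u * b.
Proof.
rewrite /Localization.map Localization.eq_locP.
rewrite !(Localization.numE, Localization.denE).
rewrite !mulr1.
by split=> -[u Mu e]; exists u => //; apply/eqP; move/eqP: e;
  rewrite mulrBr subr_eq0.
Qed.

Lemma loc_frac (y : L) :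
  exists2 s, M s & exists a, y * loc_map S s = loc_map S a.
Proof.
exists (Localization.den (repr y)); first exact: Localization.denP.
exists (Localization.num (repr y)).
rewrite -{1}[y]reprK /Localization.map loc_piM.
apply: Localization.eq_loc; rewrite !(Localization.numE, Localization.denE).
by ring.
Qed.

Lemma loc_unit s : M s -> exists v : L, v * loc_map S s = 1.
Proof.
move=> Ms; exists (\pi_L (Localization.Frac 1 Ms)).
rewrite -(rmorph1 (loc_map S)) /Localization.map loc_piM.
apply: Localization.eq_loc; rewrite !(Localization.numE, Localization.denE).
by ring.
Qed.

Lemma loc_ideal_cancel (K : set L) y s :
  is_ideal K -> M s -> K (y * loc_map S s) -> K y.
Proof.
move=> hK /loc_unit[v vs] Ky; rewrite -[y]mulr1 -vs mulrCA.
exact: ideal_mull.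
Qed.

Lemma loc_ideal_ext (K : set L) : is_ideal K ->
  ideal_ext (loc_map S) (loc_map S @^-1` K) = K.
Proof.
move=> hK; apply/seteqP; split; first exact: ideal_ext_min.
move=> y Ky; have [s Ms [a ya]] := loc_frac y.
apply: (loc_ideal_cancel (ideal_ext_ideal _ _) Ms); rewrite ya.
apply: (@ideal_ext_mem _ _ (loc_map S)); rewrite /preimage /= -ya.
exact: ideal_mulr.
Qed.

Lemma loc_ext_contract I x : is_ideal I ->
  ideal_ext (loc_map S) I (loc_map S x) <-> exists2 s, M s & I (s * x).
Proof.
move=> hI; split=> [|[s Ms Isx]]; last first.
  apply: (loc_ideal_cancel (ideal_ext_ideal _ _) Ms); rewrite -rmorphM mulrC.
  exact: ideal_ext_mem.
pose K := [set y : L | exists2 s, M s & exists2 a, I a &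
  y * loc_map S s = loc_map S a].
have M1 : M 1 by case: (mul_gen_closed S).
have hK : is_ideal K.
  split=> [|y z [s Ms [a Ia e]] [t Mt [b Ib f]]|y z [s Ms [a Ia e]]].
  - by exists 1 => //; exists 0; [case: hI|rewrite mul0r rmorph0].
  - exists (s * t); first exact: SM.
    exists (t * a + s * b); first by apply: ideal_addr => //; apply: ideal_mull.
    by rewrite rmorphD !rmorphM /= -e -f; ring.
  - have [t Mt [b f]] := loc_frac y; exists (t * s); first exact: SM.
    exists (b * a); first exact: ideal_mull.
    by rewrite !rmorphM /= -e -f; ring.
move=> /(ideal_ext_min hK)[].
  by move=> a Ia; exists 1 => //; exists a => //; rewrite rmorph1 mulr1.
move=> s Ms [a Ia]; rewrite -rmorphM => /loc_map_eq[u Mu e].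
exists (u * s); first exact: SM.
by rewrite -mulrA [s * x]mulrC e; exact: ideal_mull.
Qed.

Lemma loc_noetherian : noetherian R -> noetherian L.
Proof.
move=> noeth K hK; have [s Ks] := noeth _ (preimage_ideal (loc_map S) hK).
exists (map (loc_map S) s); rewrite -{1}(loc_ideal_ext hK) Ks ideal_ext_gen.
congr ideal_gen; apply/seteqP; split=> [_ [x xs <-]|y /mapP[x xs ->]].
  by rewrite /= map_f.
by exists x.
Qed.

Lemma loc_prime_ext (P : set L) : is_prime P -> exists p : set R,
  [/\ is_prime p, P = ideal_ext (loc_map S) p
    & forall x, P (loc_map S x) <-> p x].
Proof.
move=> PP; exists (loc_map S @^-1` P); split=> //; first exact: preimage_prime.
by rewrite loc_ideal_ext //; exact: prime_ideal.
Qed.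

Lemma loc_prime_disjoint (p : set R) : is_ideal p ->
  ideal_ext (loc_map S) p <> setT -> forall s, M s -> ~ p s.
Proof.
move=> hp pT s Ms ps; apply: pT; apply: ideal_eqT (ideal_ext_ideal _ _) _.
rewrite -(rmorph1 (loc_map S)); apply/loc_ext_contract => //.
by exists s; rewrite ?mulr1.
Qed.

Lemma loc_prime_contract (p : set R) x :
  is_prime p -> (forall s, M s -> ~ p s) ->
  ideal_ext (loc_map S) p (loc_map S x) <-> p x.
Proof.
move=> pp dis; have hp := prime_ideal pp.
split=> [|px]; last exact: ideal_ext_mem.
by case/loc_ext_contract => // s Ms; case: pp => _ _ pM /pM[/(dis _ Ms)|].
Qed.

Lemma loc_ext_prime (p : set R) : is_prime p -> (forall s, M s -> ~ p s) ->
  is_prime (ideal_ext (loc_map S) p).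
Proof.
move=> pp dis; have hP := ideal_ext_ideal (loc_map S) p.
have [p1 _] := prime_mul_closed pp; split=> // [PT|x y].
  apply: p1; rewrite -(loc_prime_contract _ pp dis) PT.
  by [].
have [s Ms [a xa]] := loc_frac x; have [t Mt [b yb]] := loc_frac y.
move=> /(ideal_mulr (loc_map S (s * t)) hP).
rewrite rmorphM mulrACA xa yb -rmorphM loc_prime_contract //.
case: pp => _ _ pM /pM[pa|pb]; [left|right].
  by apply: (loc_ideal_cancel hP Ms); rewrite xa; exact: ideal_ext_mem.
by apply: (loc_ideal_cancel hP Mt); rewrite yb; exact: ideal_ext_mem.
Qed.

Lemma mul_gen_id : mul_closed S -> M = S.
Proof. exact: smallest_id. Qed.

Section Universal.
Variables (B : comPzRingType).

Let cancelr (v c x y : B) : v * c = 1 -> x * c = y * c -> x = y.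
Proof.
by move=> vc e; rewrite -[x]mulr1 -[y]mulr1 -vc mulrCA e mulrCA.
Qed.

(** The universal property.  The value of [F] at [y] is the unique [w] with
    [w * f s = f a] for one, equivalently every, fraction [a / s] equal to
    [y]; this uniqueness [Funiq] gives additivity and multiplicativity. *)
Lemma loc_lift (f : {rmorphism R -> B}) :
  (forall s, S s -> exists v, v * f s = 1) ->
  exists F : {rmorphism L -> B}, forall a, F (loc_map S a) = f a.
Proof.
move=> fS; have {fS} /choice[v fv] s : exists v, M s -> v * f s = 1.
  have [Ms|] := pselect (M s); last by exists 0.
  suff: [set s | exists v, v * f s = 1] s by case=> v vs; exists v.
  apply: Ms; split=> //; split; first by exists 1; rewrite rmorph1 mulr1.
  move=> s' t' [x xs] [y yt]; exists (x * y).
  by rewrite rmorphM mulrACA xs yt mulr1.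
have [F FP] : exists F : L -> B, forall y s a, M s ->
    y * loc_map S s = loc_map S a -> F y * f s = f a.
  have /choice[n nP] (y : L) : exists sa : R * R, M sa.1 /\
      y * loc_map S sa.1 = loc_map S sa.2.
    by have [s Ms [a ya]] := loc_frac y; exists (s, a).
  exists (fun y => f (n y).2 * v (n y).1) => y s a Ms ya.
  have [Mn yn] := nP y.
  have /loc_map_eq[u Mu] : loc_map S ((n y).2 * s) = loc_map S (a * (n y).1).
    by rewrite !rmorphM /= -yn -ya; ring.
  move/(congr1 f); rewrite !rmorphM => e.
  apply: (cancelr (fv _ Mn)); apply: (cancelr (fv _ Mu)).
  transitivity (f u * (f (n y).2 * f s) * (v (n y).1 * f (n y).1)).
    by ring.
  by rewrite fv // mulr1 e; ring.
have Funiq y s a (w : B) : M s -> y * loc_map S s = loc_map S a ->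
    w * f s = f a -> F y = w.
  by move=> Ms ya ws; apply: (cancelr (fv _ Ms)); rewrite (FP _ _ _ Ms ya).
have M1 : M 1 by case: (mul_gen_closed S).
have Fmap a : F (loc_map S a) = f a.
  by apply: (@Funiq _ 1 a) => //; rewrite rmorph1 mulr1.
have Fzmod : zmod_morphism F.
  move=> x y.
  have [s Ms [a xa]] := loc_frac x; have [t Mt [b yb]] := loc_frac y.
  apply: (@Funiq _ (s * t) (t * a - s * b)); first exact: SM.
    by rewrite rmorphB !rmorphM /= -xa -yb; ring.
  by rewrite rmorphB !rmorphM /= -(FP _ _ _ Ms xa) -(FP _ _ _ Mt yb); ring.
have Fmon : monoid_morphism F.
  split=> [|x y]; first by rewrite -(rmorph1 (loc_map S)) Fmap rmorph1.
  have [s Ms [a xa]] := loc_frac x; have [t Mt [b yb]] := loc_frac y.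
  apply: (@Funiq _ (s * t) (a * b)); first exact: SM.
    by rewrite !rmorphM /= -xa -yb; ring.
  by rewrite !rmorphM /= -(FP _ _ _ Ms xa) -(FP _ _ _ Mt yb); ring.
pose F' : {rmorphism L -> B} := HB.pack F
  (GRing.isZmodMorphism.Build _ _ F Fzmod)
  (GRing.isMonoidMorphism.Build _ _ F Fmon).
by exists F'.
Qed.

Lemma loc_rmorph_eq (F G : {rmorphism L -> B}) :
  (forall a, F (loc_map S a) = G (loc_map S a)) -> F =1 G.
Proof.
move=> FG y; have [s Ms [a ya]] := loc_frac y; have [v vs] := loc_unit Ms.
apply: (@cancelr (F v) (F (loc_map S s))); first by rewrite -rmorphM vs rmorph1.
by rewrite {2}FG -!rmorphM ya FG.
Qed.

End Universal.
End Localization.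

(** * Invariance of local quintasymptoticity under isomorphisms *)

Section Isomorphism.
Variables (B B' : comPzRingType).
Variables (f : {rmorphism B -> B'}) (g : {rmorphism B' -> B}).
Hypotheses (fK : cancel f g) (gK : cancel g f).

Lemma iso_ideal_gen (X : set B) : ideal_gen (g @^-1` X) = g @^-1` (ideal_gen X).
Proof.
apply/seteqP; split.
  apply: ideal_gen_min; first by apply: preimage_ideal; exact: ideal_gen_ideal.
  by move=> x; exact: (@ideal_gen_sub _ X (g x)).
move=> y; rewrite -{2}(gK y) => /= Xy; move: (g y) Xy.
apply: (ideal_gen_min (K := f @^-1` (ideal_gen (g @^-1` X)))).
  by apply: preimage_ideal; exact: ideal_gen_ideal.
by move=> x Xx; apply: ideal_gen_sub; rewrite /preimage /= fK.
Qed.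

Lemma iso_ideal_ext (K : set B) : is_ideal K -> ideal_ext f K = g @^-1` K.
Proof.
move=> hK; apply/seteqP; split.
  apply: ideal_ext_min; first exact: preimage_ideal.
  by move=> x Kx; rewrite /preimage /= fK.
by move=> y Ky; rewrite -(gK y); exact: ideal_ext_mem.
Qed.

Lemma iso_minimal_prime (z : set B) :
  is_minimal_prime z -> is_minimal_prime (g @^-1` z).
Proof.
move=> [zp zmin]; split=> [|q qp qz]; first exact: preimage_prime.
rewrite -(zmin (f @^-1` q)); last by move=> x /qz; rewrite /preimage /= fK.
  by apply/seteqP; split=> y; rewrite /preimage /= gK.
exact: preimage_prime.
Qed.

End Isomorphism.

(** The map on completions is determined by its effect on representatives of
    the components, which makes functoriality immediate. *)
Lemma completion_functor (B B' : comPzRingType) (f : {rmorphism B -> B'})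
    (m : set B) (m' : set B') : is_ideal m' -> (forall x, m x -> m' (f x)) ->
  exists F : {rmorphism completion m -> completion m'},
    forall (x : completion m) k b,
    x k = RingQuot.proj (ideal_exp m k) b ->
    F x k = RingQuot.proj (ideal_exp m' k) (f b).
Proof.
move=> hm' fm.
have fmk k x : ideal_exp m k x -> ideal_exp m' k (f x).
  move=> mx; have /(ideal_exp_mono (n := k)) : ideal_ext f m `<=` m'.
    exact: ideal_ext_min.
  by apply; rewrite -ideal_ext_exp; exact: ideal_ext_mem.
pose u (x : completion m) k : Completion.layer m' k :=
  RingQuot.proj (ideal_exp m' k) (f (repr (x k))).
have uP (x : completion m) k b : x k = RingQuot.proj (ideal_exp m k) b ->
    u x k = RingQuot.proj (ideal_exp m' k) (f b).
  move=> xb; apply/(proj_eq m' k); rewrite -rmorphB; apply: fmk.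
  by apply/(proj_eq m k); rewrite -xb /RingQuot.proj reprK.
have lift (x : completion m) k :
    exists b, x k = RingQuot.proj (ideal_exp m k) b.
  exact: Completion.layer_surj.
have uT (x : completion m) k : Completion.transition (u x k.+1) = u x k.
  have [b xb] := lift x k.+1.
  rewrite (uP _ _ _ xb) Completion.transition_proj; apply/esym/uP.
  exact: component_lift (leqnSn k) xb.
pose F x := Completion.Compl (uT x).
have Fzmod : zmod_morphism F.
  move=> x y; apply: Completion.complP => k /=.
  have [a xa] := lift x k; have [b yb] := lift y k.
  rewrite (uP (x - y) k (a - b)); last by rewrite rmorphB /= -xa -yb.
  by rewrite !rmorphB /= -(uP _ _ _ xa) -(uP _ _ _ yb).
have Fmon : monoid_morphism F.
  split=> [|x y]; apply: Completion.complP => k /=.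
    by rewrite (uP 1 k 1) ?rmorph1.
  have [a xa] := lift x k; have [b yb] := lift y k.
  rewrite (uP (x * y) k (a * b)); last by rewrite rmorphM /= -xa -yb.
  by rewrite !rmorphM /= -(uP _ _ _ xa) -(uP _ _ _ yb).
pose F' : {rmorphism completion m -> completion m'} := HB.pack F
  (GRing.isZmodMorphism.Build _ _ F Fzmod)
  (GRing.isMonoidMorphism.Build _ _ F Fmon).
by exists F' => x k b; exact: uP.
Qed.

(** The induced isomorphism [F] of completions has inverse [G], and every
    ingredient of the condition is pulled back along [G]. *)
Lemma local_quintasymptotic_iso (B B' : comPzRingType) (f : {rmorphism B -> B'})
    (g : {rmorphism B' -> B}) (m E : set B) :
  cancel f g -> cancel g f -> is_ideal m ->
  local_quintasymptotic m E ->
  local_quintasymptotic (ideal_ext f m) (ideal_ext f E).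
Proof.
move=> fK gK hm; set m' := ideal_ext f m.
have hm' : is_ideal m' by exact: ideal_ext_ideal.
have [F FP] := @completion_functor _ _ f m m' hm' (@ideal_ext_mem _ _ f m).
have [|G GP] := @completion_functor _ _ g m' m hm.
  by move=> x; rewrite /m' (iso_ideal_ext fK gK).
have FK : cancel F G.
  move=> x; apply: Completion.complP => k.
  have [b xb] := Completion.layer_surj (x k).
  by rewrite (GP _ _ _ (FP _ _ _ xb)) fK.
have GK : cancel G F.
  move=> x; apply: Completion.complP => k.
  have [b xb] := Completion.layer_surj (x k).
  by rewrite (FP _ _ _ (GP _ _ _ xb)) gK.
have Fmap b : F (completion_map m b) = completion_map m' (f b).
  by apply: Completion.complP => k; exact: FP.
have extF N : ideal_ext (completion_map m') (ideal_ext f N) =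
    G @^-1` (ideal_ext (completion_map m) N).
  rewrite -(iso_ideal_ext FK GK); last exact: ideal_ext_ideal.
  rewrite -!ideal_ext_comp; congr ideal_gen.
  by apply/seteqP; split=> _ [x Nx <-]; exists x => //=; rewrite Fmap.
move=> [z zmin rad]; exists (G @^-1` z); first exact: (iso_minimal_prime FK GK).
rewrite /m' !extF -rad -preimage_setU (iso_ideal_gen FK GK).
by apply/seteqP; split=> x [n]; rewrite /preimage /= => h; exists n;
  move: h; rewrite /preimage /= rmorphXn.
Qed.

(** * Quintasymptotic primes and localization *)

Section QuintasymptoticLocalization.
Variable R : comPzRingType.
Implicit Types (I p S : set R).

Lemma quintasymptotic_primesE I p : quintasymptotic_primes I p <->
  is_prime p /\ local_quintasymptotic (ideal_ext (loc_map (~` p)) p)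
    (ideal_ext (loc_map (~` p)) I).
Proof.
have extE N : ideal_ext (@completed_local_map R p) N =
    ideal_ext (completion_map (ideal_ext (loc_map (~` p)) p))
      (ideal_ext (loc_map (~` p)) N).
  exact: (ideal_ext_comp (loc_map (~` p))
    (completion_map (ideal_ext (loc_map (~` p)) p))).
by split=> -[pp [z zmin rad]]; split=> //; exists z => //; move: rad;
  rewrite !extE.
Qed.

Lemma quintasymptotic_primes_sub I p : quintasymptotic_primes I p -> I `<=` p.
Proof.
move=> /quintasymptotic_primesE[pp lq] x Ix; have hp := prime_ideal pp.
have dis s : mul_gen (~` p) s -> ~ p s.
  by rewrite mul_gen_id //; exact: prime_mul_closed.
apply/(loc_prime_contract x pp dis).
apply: (local_quintasymptotic_sub (ideal_ext_ideal _ _) lq).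
exact: ideal_ext_mem.
Qed.

(** Both rings are universal for inverting the complement of [p]: an element
    [a / s] of [R_S] is outside [p R_S] exactly when [a] is outside [p]. *)
Lemma local_ring_localization S p : is_prime p ->
    (forall s, mul_gen S s -> ~ p s) ->
  let P := ideal_ext (loc_map S) p in
  exists (f : {rmorphism localization (~` p) -> localization (~` P)})
    (g : {rmorphism localization (~` P) -> localization (~` p)}),
  [/\ cancel f g, cancel g f
    & forall a, f (loc_map (~` p) a) = loc_map (~` P) (loc_map S a)].
Proof.
move=> pp dis P; have PP : is_prime P by exact: loc_ext_prime.
have unit_p (s : R) : ~ p s -> exists v, v * loc_map (~` p) s = 1.
  by move=> ps; apply: loc_unit; apply: sub_gen_smallest.
have unit_P (s : localization S) : ~ P s -> exists v, v * loc_map (~` P) s = 1.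
  by move=> Ps; apply: loc_unit; apply: sub_gen_smallest.
have [|f fE] := @loc_lift R (~` p) _ (loc_map (~` P) \o loc_map S).
  by move=> s ps; apply: unit_P => /(loc_prime_contract s pp dis).
have [|h hE] := @loc_lift R S _ (loc_map (~` p)).
  move=> s Ss; apply: unit_p; apply: dis; exact: sub_gen_smallest.
have [|g gE] := @loc_lift (localization S) (~` P) _ h.
  move=> y Py; have [s Ms [a ya]] := loc_frac y.
  have [|v va] := unit_p a.
    move=> pa; apply: Py; apply: (loc_ideal_cancel (prime_ideal PP) Ms).
    by rewrite ya; exact: ideal_ext_mem.
  exists (v * h (loc_map S s)).
  by rewrite mulrAC -mulrA -rmorphM ya hE.
exists f, g; split=> //.
- apply: (@loc_rmorph_eq _ _ _ (g \o f) idfun) => a /=.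
  by rewrite fE /= gE hE.
- apply: (@loc_rmorph_eq _ _ _ (f \o g) idfun) => y /=; rewrite gE.
  move: y; apply: (@loc_rmorph_eq _ _ _ (f \o h) (loc_map (~` P))) => a /=.
  by rewrite hE fE.
Qed.

End QuintasymptoticLocalization.

Section QuintasymptoticLocalization.
Variable R : comPzRingType.
Implicit Types (I p S : set R).

Lemma quintasymptotic_primes_localization S I p : is_prime p ->
  ideal_ext (loc_map S) p <> setT ->
  quintasymptotic_primes (ideal_ext (loc_map S) I) (ideal_ext (loc_map S) p) <->
  quintasymptotic_primes I p.
Proof.
move=> pp pT; have dis := loc_prime_disjoint (prime_ideal pp) pT.
have [f [g [fK gK fE]]] := local_ring_localization pp dis.
set P := ideal_ext (loc_map S) p in f g fK gK fE *.
have PP : is_prime P by exact: loc_ext_prime.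
have extf N : ideal_ext f (ideal_ext (loc_map (~` p)) N) =
    ideal_ext (loc_map (~` P)) (ideal_ext (loc_map S) N).
  rewrite -!ideal_ext_comp; congr ideal_gen.
  by apply/seteqP; split=> _ [x Nx <-]; exists x => //=; rewrite fE.
have extg N :
    ideal_ext g (ideal_ext (loc_map (~` P)) (ideal_ext (loc_map S) N)) =
    ideal_ext (loc_map (~` p)) N.
  rewrite -extf (iso_ideal_ext gK fK); last exact: ideal_ext_ideal.
  rewrite (iso_ideal_ext fK gK); last exact: ideal_ext_ideal.
  by apply/seteqP; split=> x; rewrite /preimage /= fK.
split=> /quintasymptotic_primesE[_ lq];
  apply/quintasymptotic_primesE; split=> //.
  have := local_quintasymptotic_iso gK fK (ideal_ext_ideal _ _) lq.
  by rewrite /P !extg.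
have := local_quintasymptotic_iso fK gK (ideal_ext_ideal _ _) lq.
by rewrite !extf.
Qed.

(** In the local ring some [y = a / s] outside [I ^ n R_p] satisfies
    [y p <= I ^ n R_p].  As [p] is finitely generated, one [v] outside [p]
    gives [v * a * p <= I ^ n]; then [(I ^ n : v * a)] is no larger than [p],
    because [y] is not in [I ^ n R_p]. *)
Lemma quintasymptotic_primes_ass I p : noetherian R -> is_ideal I ->
  quintasymptotic_primes I p ->
  exists n a, p = [set x | ideal_exp I n (x * a)].
Proof.
move=> noeth hI /quintasymptotic_primesE[pp lq]; have hp := prime_ideal pp.
have Mp : mul_gen (~` p) = ~` p by apply: mul_gen_id; exact: prime_mul_closed.
have [n [y [Iy my]]] := local_quintasymptotic_ass (ideal_ext_ideal _ _)
  (loc_noetherian noeth) (ideal_ext_ideal _ _) lq.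
move: Iy my; rewrite -ideal_ext_exp => Iy my.
have hIn := ideal_exp_ideal I n.
have hJ := ideal_ext_ideal (loc_map (~` p)) (ideal_exp I n).
have [s ps [a ya]] := loc_frac y.
have [t ts] := noeth _ hp.
have [v pv Iv] : exists2 v, ~ p v &
    forall g, g \in t -> ideal_exp I n (v * (g * a)).
  have : [set` t] `<=` p by rewrite ts; exact: ideal_gen_sub.
  have [p1 pM] := prime_mul_closed pp.
  elim: t {ts} => [_|g t IH tp]; first by exists 1.
  have [h ht|v pv Iv] := IH; first by apply: tp; rewrite /= inE ht orbT.
  have : ideal_ext (loc_map (~` p)) (ideal_exp I n) (loc_map (~` p) (g * a)).
    rewrite rmorphM /= -ya mulrCA mulrA; apply: (ideal_mulr _ hJ).
    by apply: my; apply: ideal_ext_mem; apply: tp; rewrite /= mem_head.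
  case/loc_ext_contract => // u; rewrite Mp => pu Iu.
  exists (u * v); first exact: pM.
  move=> h; rewrite inE => /orP[/eqP->|/Iv Ih].
    by rewrite mulrAC; exact: ideal_mulr.
  by rewrite -mulrA; exact: ideal_mull.
exists n, (v * a); apply/seteqP; split=> x.
  rewrite ts.
  apply: (ideal_gen_min (K := [set x | ideal_exp I n (x * (v * a))])).
    exact: colon_ideal.
  by move=> g /Iv; rewrite /= mulrCA.
move=> /= Ix; apply: contrapT => px; apply: Iy.
apply: (loc_ideal_cancel hJ ps); rewrite ya.
apply/loc_ext_contract => //; exists (x * v); last by rewrite -mulrA.
by rewrite Mp; exact: (prime_mul_closed pp).2.
Qed.

End QuintasymptoticLocalization.

Lemma quintasymptotic_primes_finite (R : comNzRingType) (I : set R) :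
  noetherian R -> is_ideal I ->
  exists F : seq (set R), forall p, quintasymptotic_primes I p -> p \in F.
Proof.
move=> noeth hI; have [F FP] := finite_associated_primes_powers noeth hI.
exists F => p qp; have [n [a pE]] := quintasymptotic_primes_ass noeth hI qp.
by apply: FP pE; case: qp.
Qed.

(** Finiteness is essential here: an ideal may be covered by an infinite set
    of primes none of which contains it. *)
Lemma maximal_quintasymptotic_prime (R : comNzRingType) (I m : set R) :
  noetherian R -> is_ideal I -> is_maximal m ->
  (forall y, m y -> exists2 p, quintasymptotic_primes I p & p y) ->
  quintasymptotic_primes I m.
Proof.
move=> noeth hI mmax mQ; have [F FP] := quintasymptotic_primes_finite noeth hI.
have [hm mT mmax'] := mmax.
apply: contrapT => Qm.
have [p|y my yF] := @prime_avoidance R m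
    [seq p <- F | `[< quintasymptotic_primes I p >]] hm.
  rewrite mem_filter => /andP[/asboolP Qp _]; have [pp _] := Qp; split=> // mp.
  by apply: Qm; rewrite -(mmax' p) //; case: pp.
have [p Qp py] := mQ y my; apply: (yF p) => //.
by rewrite mem_filter FP // andbT; apply/asboolP.
Qed.

(** * Quintasymptotic sequences *)

Section Sequences.
Variable R : comPzRingType.
Implicit Types (I S : set R) (xs : seq R).

Lemma ideal_adjoin_ideal I xs : is_ideal (ideal_adjoin I xs).
Proof. exact: ideal_gen_ideal. Qed.

Lemma quintasymptotic_sequence_localization S I xs :
  ideal_ext (loc_map S) (ideal_adjoin I xs) <> setT ->
  quintasymptotic_sequence I xs ->
  quintasymptotic_sequence (ideal_ext (loc_map S) I) (map (loc_map S) xs).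
Proof.
move=> ST [_ xsQ]; split; first by rewrite -ideal_ext_adjoin.
move=> i; rewrite size_map => ilt P; rewrite -map_take -ideal_ext_adjoin => QP.
have [PP _] := QP; have [p [pp PE Pp]] := loc_prime_ext PP.
have pT : ideal_ext (loc_map S) p <> setT by rewrite -PE; case: PP.
rewrite (nth_map 0) // => /Pp; apply: xsQ => //.
by apply/(quintasymptotic_primes_localization _ pp pT); rewrite -PE.
Qed.

Lemma quintasymptotic_sequence_delocalization S I xs :
  ideal_ext (loc_map S) (ideal_adjoin I xs) <> setT ->
  (forall i p, (i < size xs)%N ->
     quintasymptotic_primes (ideal_adjoin I (take i xs)) p ->
     ideal_ext (loc_map S) p <> setT) ->
  quintasymptotic_sequence (ideal_ext (loc_map S) I) (map (loc_map S) xs) ->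
  quintasymptotic_sequence I xs.
Proof.
move=> ST QT [_ xsQ]; split=> [IT|i ilt p Qp pxi].
  apply: ST; rewrite IT; apply: ideal_eqT; first exact: ideal_ext_ideal.
  by rewrite -(rmorph1 (loc_map S)); exact: ideal_ext_mem.
have pT := QT _ _ ilt Qp; have [pp _] := Qp.
apply: (xsQ i _ (ideal_ext (loc_map S) p)); rewrite ?size_map //.
  rewrite -map_take -ideal_ext_adjoin.
  by apply/quintasymptotic_primes_localization.
by rewrite (nth_map 0) //; exact: ideal_ext_mem.
Qed.

Lemma quintasymptotic_sequence_rcons I xs y :
  quintasymptotic_sequence I (rcons xs y) <->
  [/\ ideal_adjoin I (rcons xs y) <> setT, quintasymptotic_sequence I xs
    & forall p, quintasymptotic_primes (ideal_adjoin I xs) p -> ~ p y].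
Proof.
have takeE i : (i <= size xs)%N -> take i (rcons xs y) = take i xs.
  by move=> le_i; rewrite -cats1 takel_cat.
split=> [[IT Q]|[IT [_ Q] Qy]]; split=> //.
- split=> [IT'|i ilt p].
    apply: IT; apply: ideal_eqT; first exact: ideal_adjoin_ideal.
    apply: (ideal_genS (X := I `|` [set` xs])).
      by move=> x [Ix|xsx]; [left|right; rewrite /= mem_rcons inE xsx orbT].
    by rewrite -/(ideal_adjoin _ _) IT'.
  rewrite -takeE ?(ltnW ilt) // => Qp; have := Q i _ p Qp.
  by rewrite nth_rcons ilt; apply; rewrite size_rcons ltnS ltnW.
- move=> p Qp; have := Q (size xs) _ p.
  rewrite takeE // take_size nth_rcons ltnn eqxx; apply=> //.
  by rewrite size_rcons.
move=> i; rewrite size_rcons ltnS leq_eqVlt => /orP[/eqP->|ilt] p.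
  by rewrite takeE // take_size nth_rcons ltnn eqxx; exact: Qy.
by rewrite takeE ?(ltnW ilt) // nth_rcons ilt; exact: Q.
Qed.

End Sequences.

Theorem proposition2p5 (R : comNzRingType) (R_noeth : noetherian R)
    (I : set R) (I_ideal : is_ideal I) (xs : seq R) :
  (forall S : set R, mul_closed S ->
     ideal_ext (loc_map S) (ideal_adjoin I xs) <> setT ->
     (quintasymptotic_sequence I xs ->
      quintasymptotic_sequence (ideal_ext (loc_map S) I)
        [seq loc_map S x | x <- xs]) /\
     ((forall p : set R,
         (\bigcup_(i in [set i : nat | (i < size xs)%N])
            quintasymptotic_primes (ideal_adjoin I (take i xs))) p ->
         ideal_ext (loc_map S) p <> setT) ->
      quintasymptotic_sequence (ideal_ext (loc_map S) I)
        [seq loc_map S x | x <- xs] ->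
      quintasymptotic_sequence I xs)) /\
  (maximal_quintasymptotic_sequence I xs ->
   forall m : set R, is_maximal m -> ideal_adjoin I xs `<=` m ->
     maximal_quintasymptotic_sequence (ideal_ext (@local_map R m) I)
       [seq local_map m x | x <- xs]) /\
  (I <> setT ->
   (forall x : R, x \in xs -> jacobson_radical x) ->
   (forall m : set R, is_maximal m -> ideal_adjoin I xs `<=` m ->
     maximal_quintasymptotic_sequence (ideal_ext (@local_map R m) I)
       [seq local_map m x | x <- xs]) ->
   maximal_quintasymptotic_sequence I xs).
Proof.
have proper (m J : set R) : is_maximal m -> J `<=` m ->
    ideal_ext (loc_map (~` m)) J <> setT.
  move=> mmax Jm JT; have mp := maximal_prime mmax.
  have [m1 _] := prime_mul_closed mp; apply: m1.
  have dis s : mul_gen (~` m) s -> ~ m s.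
    by rewrite mul_gen_id //; exact: prime_mul_closed.
  apply/(loc_prime_contract 1 mp dis).
  have : ideal_ext (loc_map (~` m)) J (loc_map (~` m) 1) by rewrite JT.
  by apply: ideal_genS; exact: image_subset.
split=> [S _ ST|]; last split.
- split; first exact: quintasymptotic_sequence_localization.
  move=> Qp; apply: quintasymptotic_sequence_delocalization => // i p ilt Qip.
  by apply: Qp; exists i.
- (* maximality puts [m] in the union of the quintasymptotic primes of
     [(I, xs)], so [m] is one of them, and then so is [m R_m] *)
  move=> [xsQ xsmax] m mmax Jm; rewrite /local_map; have [hm mT _] := mmax.
  split.
    exact: quintasymptotic_sequence_localization (proper _ _ mmax Jm) xsQ.
  have Qm : quintasymptotic_primes (ideal_adjoin I xs) m.
    apply: maximal_quintasymptotic_prime => //; first exact: ideal_adjoin_ideal.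
    move=> y my; apply: contrapT => noQ; apply: (xsmax y).
    apply/quintasymptotic_sequence_rcons; split=> //.
      move=> JT; apply: mT; apply/seteqP; split=> // x _.
      have : ideal_adjoin I (rcons xs y) x by rewrite JT.
      apply: ideal_gen_min => // z [Iz|].
        by apply: Jm; apply: ideal_gen_sub; left.
      rewrite /= mem_rcons inE => /orP[/eqP->//|zxs].
      by apply: Jm; apply: ideal_gen_sub; right.
    by move=> p Qp py; apply: noQ; exists p.
  move=> y /quintasymptotic_sequence_rcons[yT _ yQ].
  set P := ideal_ext (loc_map (~` m)) m.
  have QP : quintasymptotic_primes
      (ideal_ext (loc_map (~` m)) (ideal_adjoin I xs)) P.
    apply/quintasymptotic_primes_localization => //; first exact: maximal_prime.
    exact: proper.
  apply: (yQ P); first by rewrite -ideal_ext_adjoin.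
  have hP := ideal_ext_ideal (loc_map (~` m)) m.
  apply: contrapT => Py; apply: yT.
  set K := ideal_adjoin _ _; have hK : is_ideal K by exact: ideal_adjoin_ideal.
  apply: (ideal_eqT hK).
  have [s Ms [a ya]] := loc_frac y.
  have ma : ~ m a.
    move=> ma; apply: Py; apply: (loc_ideal_cancel hP Ms).
    by rewrite ya; exact: ideal_ext_mem.
  have [|v va] := @loc_unit R (~` m) a; first exact: sub_gen_smallest.
  rewrite -va -ya; apply: (ideal_mull _ hK); apply: (ideal_mulr _ hK).
  by apply: ideal_gen_sub; right; rewrite /= mem_rcons mem_head.
(* every failure is visible at a maximal ideal containing [I], and these
   contain [xs], which is in the Jacobson radical *)
move=> IT xsJ locmax.
have adjm (ys : seq R) m : is_maximal m -> I `<=` m -> {subset ys <= xs} ->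
    ideal_adjoin I ys `<=` m.
  move=> mmax Im ysx; have [hm _ _] := mmax.
  apply: ideal_gen_min => // x [/Im//|/ysx/xsJ].
  exact.
have sub_I (ys : seq R) : I `<=` ideal_adjoin I ys.
  by move=> x Ix; apply: ideal_gen_sub; left.
have xsQ : quintasymptotic_sequence I xs.
  split=> [JT|i ilt p Qp pxi].
    have [m mmax Im] := noetherian_sub_maximal R_noeth I_ideal IT.
    have [_ mT _] := mmax; apply: mT; apply/seteqP; split=> // x _.
    by apply: (adjm xs m mmax Im) => //; rewrite JT.
  have [pp _] := Qp; have [hp pT _] := pp.
  have [m mmax pm] := noetherian_sub_maximal R_noeth hp pT.
  have Im : I `<=` m.
    apply: subset_trans pm; apply: subset_trans (quintasymptotic_primes_sub Qp).
    exact: sub_I.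
  have Jm : ideal_adjoin I xs `<=` m by exact: adjm.
  have [[_ locQ] _] := locmax m mmax Jm.
  apply: (locQ i _ (ideal_ext (loc_map (~` m)) p)); rewrite ?size_map //.
    rewrite -map_take -ideal_ext_adjoin.
    by apply/quintasymptotic_primes_localization => //; exact: proper.
  by rewrite (nth_map 0) //; exact: ideal_ext_mem.
split=> // y Qy.
have [m mmax Jm] :=
  noetherian_sub_maximal R_noeth (ideal_adjoin_ideal _ _) Qy.1.
have [_ /(_ (loc_map (~` m) y))] : maximal_quintasymptotic_sequence
    (ideal_ext (loc_map (~` m)) I) (map (loc_map (~` m)) xs).
  apply: locmax => //; apply: subset_trans Jm; apply: ideal_genS.
  by move=> x [Ix|xsx]; [left|right; rewrite /= mem_rcons inE xsx orbT].
apply; rewrite -map_rcons.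
exact: quintasymptotic_sequence_localization (proper _ _ mmax Jm) Qy.
Qed.
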